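(* Suppose that $\operatorname{cof}(LM) = \aleph_1$ and that $H$ is a nontrivial finite perfect group. Then there exists a strongly bounded group of cardinality $\aleph_1$ which is a subgroup of the direct product $\prod_{\omega} H$ (countably many copies of $H$).
   Context: A group $G$ is strongly bounded if for every action of $G$ by isometries on a metric space (an arbitrary abstract action), every orbit has finite diameter. A group $H$ is perfect if it equals its commutator subgroup. $\operatorname{cof}(LM)$ is the cofinality of the ideal of Lebesgue null subsets of $\mathbb{R}$: the least cardinality of a family $\mathcal{F}$ of Lebesgue null sets such that every Lebesgue null set is contained in some member of $\mathcal{F}$. Equivalently, it is the least cardinality of a family $\mathcal{F}$ of sets of the form $\prod_{n\in\omega} T_n \subseteq \omega^\omega$ with each $T_n \subseteq \omega$, $|T_n| \le n+1$, whose union is $\omega^\omega$. *)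

(* Defs.v *)
From HB Require Import structures.
From mathcomp Require Import all_boot all_order all_algebra all_fingroup.
From mathcomp Require Import all_classical all_reals all_analysis.
From mathcomp Require Import Rstruct Rstruct_topology.
Set Implicit Arguments. Unset Strict Implicit. Unset Printing Implicit Defensive.
Import Order.TTheory GRing.Theory Num.Theory.

Notation RR := Rdefinitions.R.

Definition countableT (T : Type) : Prop := exists f : T -> nat, injective f.

(* T has cardinality aleph_1: T is uncountable and carries a strict
   well-order all of whose proper initial segments are countable
   (i.e. T has order type omega_1). *)
Definition card_aleph1 (T : Type) : Prop :=
  ~ countableT T /\
  exists lt : T -> T -> Prop,
    (forall x, ~ lt x x) /\
    (forall x y z, lt x y -> lt y z -> lt x z) /\
    (forall x y, x = y \/ lt x y \/ lt y x) /\
    well_founded lt /\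
    (forall x, countableT {y : T | lt y x}).

Definition lebesgue_null (A : set RR) : Prop :=
  (@lebesgue_measure RR).-negligible A.

Definition null_cofinal (I : Type) (F : I -> set RR) : Prop :=
  (forall i, lebesgue_null (F i)) /\
  (forall A, lebesgue_null A -> exists i, (A `<=` F i)%classic).

Definition cof_LM_eq_aleph1 : Prop :=
  (exists (I : Type) (F : I -> set RR), card_aleph1 I /\ null_cofinal F) /\
  (forall (J : Type) (G : J -> set RR), countableT J -> ~ null_cofinal G).

Section Prod.
Variable gT : finGroupType.
Local Open Scope group_scope.

Definition pmul (f g : nat -> gT) : nat -> gT := fun n => f n * g n.
Definition pinv (f : nat -> gT) : nat -> gT := fun n => (f n)^-1.
Definition pone : nat -> gT := fun _ => 1.

Definition subgroup_of_power (H : {group gT}) (S : (nat -> gT) -> Prop) : Prop :=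
  (forall f, S f -> forall n, f n \in H) /\
  S pone /\
  (forall f g, S f -> S g -> S (pmul f g)) /\
  (forall f, S f -> S (pinv f)).

Definition is_metric (X : Type) (d : X -> X -> RR) : Prop :=
  (forall x y, (0 <= d x y)%R) /\
  (forall x y, d x y = 0%R <-> x = y) /\
  (forall x y, d x y = d y x) /\
  (forall x y z, (d x z <= d x y + d y z)%R).

Definition strongly_bounded (S : (nat -> gT) -> Prop) : Prop :=
  forall (X : Type) (d : X -> X -> RR), is_metric d ->
  forall act : (nat -> gT) -> X -> X,
    (forall x, act pone x = x) ->
    (forall f g, S f -> S g -> forall x, act (pmul f g) x = act f (act g x)) ->
    (forall f, S f -> forall x y, d (act f x) (act f y) = d x y) ->
    forall x, exists B : RR,
      forall f g, S f -> S g -> (d (act f x) (act g x) <= B)%R.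
End Prod.

(* Main.v *)
(* Proof idea. Let [S] be the group of functions into [H] measurable with
   respect to a set algebra [B] on [nat] of cardinality aleph_1. Given a length
   function [L] on [S], the sum over [h] of the lengths of [h] times the
   indicator of [b] is a quasi-subadditive length of [b] in [B]: complements and
   unions are clear, and intersections come from commutators since [H] is
   perfect. On a logarithmic scale it is a "quasirank", which each Boolean
   operation increases by at most 1, and [S] is strongly bounded as soon as every
   quasirank on [B] is bounded.

   [B] is a tower of countable algebras of length omega_1 in which, for each
   stage and each pair of slaloms from a covering family of size aleph_1, a later
   stage contains the sets [new_set]; cof(LM) = aleph_1 supplies the slaloms
   (Bartoszynski). Given an unbounded quasirank [r], choose an ultrafilter of a
   countable stage, seen as a branch [z], along which unboundedness persists; a
   slalom guesses [z] and the table of sets of low rank level by level. At each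
   level the finitely many guessed branches leave room for a piece on which
   low-rank sets have small density, so one finite choice of subset avoids
   the low-rank sets of all guesses at once. This first yields infinitely many
   disjoint unbounded sets in [B], and applied to those it yields one set of [B]
   whose rank exceeds every bound. *)
From mathcomp Require Import all_boot all_order all_algebra all_fingroup.
From mathcomp Require Import all_classical all_reals all_analysis.
From mathcomp Require Import Rstruct Rstruct_topology ring lra.
Require Import Defs.
Set Implicit Arguments. Unset Strict Implicit. Unset Printing Implicit Defensive.
Import Order.TTheory GRing.Theory Num.Theory.
Import numFieldNormedType.Exports.

(** * Slaloms from null sets *)

Lemma finite_enum (P : nat -> Prop) (N : nat) :
  (forall s, uniq s -> (forall i, i \in s -> P i) -> size s <= N) ->
  exists2 s : seq nat, size s <= N & forall i, P i -> i \in s.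
Proof.
move=> sN.
pose good n := `[<exists s : seq nat, [/\ uniq s, forall i, i \in s -> P i & size s = n]>].
have g0 : exists n, good n by exists 0; apply/asboolP; exists [::].
have gN n : good n -> n <= N by move=> /asboolP[s [us sP <-]]; apply: sN.
case: (ex_maxnP g0 gN) => n /asboolP[s [us sP szs]] nmax; exists s; first exact: sN.
move=> i Pi; apply: contraT => nis.
have : size (i :: s) <= n.
  apply: nmax; apply/asboolP; exists (i :: s); split=> //; first by rewrite /= nis.
  by move=> k; rewrite inE => /orP[/eqP->|/sP].
by rewrite /= szs ltnn.
Qed.

Section Slaloms.
Variable R : realType.
Local Open Scope ring_scope.
Local Open Scope classical_set_scope.
Let mu := (@lebesgue_measure R).

Definition cell (b m k : nat) : set R :=
  `[k%:R / b%:R ^+ m, k.+1%:R / b%:R ^+ m]%classic.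

(** The first of the [b] subcells of [cell b m k], taken open for the sake of the Baire argument. *)
Definition cell0 (b m k : nat) : set R :=
  `]k%:R / b%:R ^+ m, (k * b).+1%:R / b%:R ^+ m.+1[%classic.

(* The interior of the set of reals in [[0, 1]] whose [m]-th digit in base [b] is [0]. *)
Definition digit0 (b m : nat) : set R :=
  \big[setU/set0]_(k < (b ^ m)%N) cell0 b m k.

Lemma digit0_open b m : open (digit0 b m).
Proof.
rewrite /digit0 -(bigcup_mkord _ (cell0 b m)).
by apply: bigcup_open => k _; exact: interval_open.
Qed.

Lemma digit0_measurable b m : measurable (digit0 b m).
Proof. by apply: measurable_realfun.open_measurable; exact: digit0_open. Qed.

Lemma measure_digit0_le b m : (0 < b)%N -> (mu (digit0 b m) <= (b%:R^-1)%:E)%E.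
Proof.
move=> b0; have q0 : 0 < b%:R :> R by rewrite ltr0n.
apply: (@le_trans _ _ (\sum_(k < (b ^ m)%N) ((b%:R ^+ m.+1)^-1 : R)%:E)%E).
  apply: (@le_trans _ _ (\sum_(k < (b ^ m)%N) mu (cell0 b m k))%E).
    apply: (@content_subadditive _ _ _ mu _ (cell0 b m)) => //.
      by move=> k _; exact: measurable_itv.
    exact: digit0_measurable.
  apply: lee_sum => k _; rewrite /mu /cell0 lebesgue_measure_itv /=.
  case: ifPn => _; last by rewrite lee_fin invr_ge0 exprn_ge0 // ltW.
  rewrite -EFinB lee_fin -addn1 natrD mulrDl natrM exprSr -mulf_div divff ?gt_eqF //.
  by rewrite mulr1 mul1r addrAC subrr add0r.
rewrite sumEFin lee_fin sumr_const card_ord -[_ *+ _]mulr_natl natrX exprS invfM mulrCA.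
by rewrite divff ?mulr1 // gt_eqF // exprn_gt0.
Qed.

Lemma segment_cover (a h x : R) n : (0 < n)%N -> a <= x <= a + n%:R * h ->
  exists2 i, (i < n)%N & a + i%:R * h <= x <= a + i.+1%:R * h.
Proof.
elim: n => // -[|n] IHn _ /andP[ax xa].
  by exists 0%N => //; rewrite mul0r addr0 ax.
case: (lerP x (a + n.+1%:R * h)) => xn.
  have [|i lt_in h1] := IHn isT; first by rewrite ax.
  by exists i => //; apply: leq_trans lt_in _.
by exists n.+1 => //; rewrite ltW.
Qed.

(** Digits are independent. Induction on [d] splits the cell into [b] cells of the next level; if
    [T m] holds, the first of them contributes nothing. *)
Lemma measure_avoid_digits b (T : pred nat) d m k : (0 < b)%N -> (k < b ^ m)%N ->
  (mu (cell b m k `\`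
       \big[setU/set0]_(i <- iota m d | T i) digit0 b i)
   <= ((b%:R ^+ m)^-1 * (1 - b%:R^-1) ^+ count T (iota m d))%:E)%E.
Proof.
move=> b0; have q0 : 0 < b%:R :> R by rewrite ltr0n.
have mU s : measurable (\big[setU/set0]_(i <- s | T i) digit0 b i).
  by apply: bigsetU_measurable => i _; apply: digit0_measurable.
elim: d m k => [|d IHd] m k lt_k.
  rewrite big_nil setD0 /mu /cell lebesgue_measure_itv /= expr0 mulr1.
  case: ifPn => _; last by rewrite lee_fin invr_ge0 exprn_ge0 // ltW.
  by rewrite -EFinB lee_fin -addn1 natrD mulrDl mul1r addrAC subrr add0r.
rewrite big_cons /=.
set c := count T (iota m.+1 d); set U := \big[setU/set0]_(i <- iota m.+1 d | T i) _.
pose a : R := k%:R / b%:R ^+ m; pose h : R := (b%:R ^+ m.+1)^-1.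
have h0 : 0 < h by rewrite invr_gt0 exprn_gt0.
have aE i : (k * b + i)%:R / b%:R ^+ m.+1 = a + i%:R * h.
  rewrite natrD mulrDl natrM exprSr -mulf_div divff ?gt_eqF // mulr1 -exprSr //.
(* Since [cell0] is open, removing it leaves the two end points of the first subcell. *)
pose A i : set R := if T m && (i == 0%N) then [set a; a + h] else
   cell b m.+1 (k * b + i) `\` U.
have mA i : measurable (A i).
  rewrite /A; case: ifP => _; first by apply: measurableU; exact: measurable_set1.
  by apply: measurableD; [exact: measurable_itv | exact: mU].
apply: (@le_trans _ _ (\sum_(i < b) mu (A i))%E).
  apply: (@content_subadditive _ _ _ mu _ A) => //.
  - by move=> i _; apply: mA.
  - apply: measurableD; first exact: measurable_itv.
    case: ifP => _; last exact: mU.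
    by apply: measurableU; [exact: digit0_measurable | exact: mU].
  - move=> x [/= xk xU]; rewrite -(bigcup_mkord _ A).
  have [||i lt_ib xi] := @segment_cover a h x b => //.
    move: xk; rewrite /cell /= in_itv /= -/a => /andP[-> /=]; congr (_ <= _).
    by rewrite -aE -mulSnr natrM exprSr -mulf_div divff ?mulr1 // gt_eqF.
  exists i => //; rewrite /A; case: ifPn => [/andP[Tm /eqP i0]|nT].
    move: xi; rewrite i0 mul0r addr0 mul1r => /andP[].
    rewrite le_eqVlt => /orP[/eqP->|ax]; first by left.
    rewrite le_eqVlt => /orP[/eqP->|xa]; first by right.
    case: xU; rewrite Tm; left; rewrite /digit0.
    rewrite -(bigcup_mkord _ (cell0 b m)).
    exists k => //=; rewrite /cell0 /= in_itv /= -/a ax /= -addn1 aE mul1r //.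
  split; first by rewrite /cell /= in_itv /= -addnS !aE.
  by move=> xU'; apply: xU; case: ifP => // _; right.
have leA (i : 'I_b) : (mu (A i) <= (if T m && (i == 0%N :> nat) then 0 else h * (1 - b%:R^-1) ^+ c)%:E)%E.
  rewrite /A; case: ifPn => _.
    apply: (@le_trans _ _ (mu [set a] + mu [set (a + h)%R])%E); first exact: measureU2.
    have h1 y : mu [set y] = 0%E by exact: lebesgue_measure_set1.
    by rewrite !h1 adde0.
  apply: IHd; rewrite expnSr; apply: (@leq_trans (k * b + b)); first by rewrite ltn_add2l.
  by rewrite -mulSnr leq_mul2r lt_k orbT.
apply: le_trans (lee_sum _ (fun i _ => leA i)) _.
rewrite sumEFin lee_fin -(prednK b0) big_ord_recl /= andbT.
under eq_bigr do rewrite /= andbF.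
rewrite sumr_const card_ord prednK //.
have qE : (b%:R ^+ m)^-1 = h * b%:R by rewrite /h exprSr invfM -mulrA mulVf ?mulr1 // gt_eqF.
rewrite qE; set y := _ ^+ c.
have bE : b%:R = b.-1%:R + 1 :> R by rewrite -{1}(prednK b0) -addn1 natrD.
have cb : b%:R * (1 - b%:R^-1) = b.-1%:R :> R.
  by rewrite mulrBr mulr1 divff ?gt_eqF // bE addrK.
case: (T m) => /=; rewrite ?add1n ?add0n.
  rewrite add0r -[_ *+ _]mulr_natl exprS -/y.
  have -> : h * b%:R * ((1 - b%:R^-1) * y) = b%:R * (1 - b%:R^-1) * (h * y) by ring.
  by rewrite cb.
have -> : h * b%:R * y = b%:R * (h * y) by ring.
by rewrite bE mulrDl mul1r addrC mulr_natl.
Qed.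

Let unit_itv : set R := `[0, 1].

Lemma measure_avoid_list b (s : seq nat) : (0 < b)%N -> uniq s ->
  (mu (unit_itv `\` \big[setU/set0]_(i <- s) digit0 b i)
    <= ((1 - b%:R^-1) ^+ size s)%:E)%E.
Proof.
move=> b0 us; pose M := (\max_(i <- s) i).+1.
have lt_sM i : i \in s -> (i < M)%N by move=> i_s; rewrite /M ltnS (big_rem i i_s) /= leq_maxl.
have := @measure_avoid_digits b (mem s) M 0 0 b0 isT.
rewrite /cell expr0 invr1 !mulr1 !mul1r => H.
have -> : size s = count (mem s) (iota 0 M).
  rewrite -size_filter; apply: perm_size; apply: uniq_perm => //.
    by rewrite filter_uniq // iota_uniq.
  move=> i; rewrite mem_filter mem_iota /= add0n.
  by case: (boolP (i \in s)) => //= /lt_sM.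
apply: le_trans H; apply: le_measure; rewrite ?inE.
- apply: measurableD; [exact: measurable_itv | apply: bigsetU_measurable => i _; exact: digit0_measurable].
- apply: measurableD; [exact: measurable_itv | apply: bigsetU_measurable => i _; exact: digit0_measurable].
- move=> x [x01 xs]; split=> // xT; apply: xs.
  move: xT; rewrite -!bigcup_seq_cond /= => -[i /= /andP[_ i_s] xi].
  by exists i; rewrite //= andbT.
Qed.

Lemma bernoulli_decay (x : R) n : 0 <= x <= 1 -> (1 - x) ^+ n * (n%:R * x) <= 1.
Proof.
move=> /andP[x0 x1]; suff : (1 - x) ^+ n * (1 + n%:R * x) <= 1.
  apply: le_trans; rewrite ler_wpM2l ?exprn_ge0 ?subr_ge0 // lerDr //.
elim: n => [|n IHn]; first by rewrite expr0 mul0r addr0 mulr1.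
apply: le_trans IHn; rewrite exprSr -mulrA ler_wpM2l ?exprn_ge0 ?subr_ge0 //.
have n0 : 0 <= n%:R :> R by [].
rewrite -addn1 natrD; nra.
Qed.

(** Up to a null set, [E] avoids all digit sets listed in [s], so its measure is at most
    [(1 - 1/b) ^ size s]. By Bernoulli [size s] is at most [b] divided by the measure of [E]; the
    constant [c] depends on [E] alone. *)
Lemma size_null_digits (E : set R) : measurable E -> E `<=` `[0, 1] ->
  ~ mu.-negligible E -> exists c : nat, forall b s, (0 < b)%N -> uniq s ->
  (forall i, i \in s -> mu.-negligible (E `&` digit0 b i)) -> (size s <= c * b)%N.
Proof.
move=> mE E01 nE.
have muE1 : (mu E <= 1)%E.
  apply: (@le_trans _ _ (mu `[0, 1]%classic)); first by apply: le_measure; rewrite ?inE.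
  by rewrite /mu lebesgue_measure_itv /= lte_fin ltr01 sube0.
have muE0 : (0 < mu E)%E.
  rewrite lt0e measure_ge0 andbT; apply/eqP => E0; apply: nE; exact/negligibleP.
have finE : mu E \is a fin_num.
  by rewrite ge0_fin_numE ?measure_ge0 // (le_lt_trans muE1) // ltry.
set v := fine (mu E).
have v0 : 0 < v by rewrite fine_gt0 // muE0 (le_lt_trans muE1) // ltry.
exists (Num.bound v^-1) => b s b0 us sE.
have q0 : 0 < b%:R :> R by rewrite ltr0n.
pose U : set R := \big[setU/set0]_(i <- s) digit0 b i.
have mU : measurable U by apply: bigsetU_measurable => i _; exact: digit0_measurable.
have EU : mu (E `&` U) = 0%E.
  apply/negligibleP; first exact: measurableI.
  rewrite /U big_distrr /= big_seq.
  apply: (@negligible_bigsetU _ _ _ mu (fun i => E `&` digit0 b i)) => i; exact: sE.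
have vle : v <= (1 - b%:R^-1) ^+ size s.
  rewrite -lee_fin fineK //.
  have -> : mu E = (mu (E `\` U) + mu (E `&` U))%E.
    exact: measureDI.
  rewrite EU adde0; apply: le_trans (measure_avoid_list b0 us).
  apply: le_measure; rewrite ?inE; [exact: measurableD | apply: measurableD; [exact: measurable_itv | exact: mU] |].
  by move=> x [Ex Ux]; split=> //; exact: E01.
have x01 : 0 <= (b%:R^-1 : R) <= 1.
  by rewrite invr_ge0 ltW //= invf_le1 // ler1n.
have := bernoulli_decay (size s) x01.
have sq0 : 0 <= (size s)%:R / b%:R :> R by rewrite divr_ge0 // ltW.
move=> le1; have vs : v * ((size s)%:R / b%:R) <= 1.
  by apply: le_trans le1; rewrite ler_wpM2r.
rewrite -(ler_nat R) natrM -ler_pdivrMr //.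
apply: (@le_trans _ _ v^-1); first by rewrite -[v^-1]mul1r ler_pdivlMr // mulrC.
by apply/ltW/archi_boundP; rewrite invr_ge0 ltW.
Qed.

(** Base [2 ^ n.+1] makes the measures summable, so Borel-Cantelli gives a null set; as a limsup of
    open sets it is a countable intersection of open sets, as Baire category requires. *)
Definition coded_null (g : nat -> nat) : set R :=
  lim_sup_set (fun n => digit0 (2 ^ n.+1)%N (g n)).

Lemma coded_null_negligible g : mu.-negligible (coded_null g).
Proof.
have mD n : measurable (digit0 (2 ^ n.+1)%N (g n)) by exact: digit0_measurable.
apply/negligibleP.
  by apply: bigcapT_measurable => n; apply: bigcup_measurable => k _; exact: mD.
apply: lim_sup_set_cvg0; first exact: mD.
apply: (@le_lt_trans _ _ 1%E); last exact: ltry.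
apply: le_trans (@epsilon_trick0 R 1 xpredT ler01).
apply: lee_nneseries => n _; first by move=> _; apply: measure_ge0.
by rewrite mul1r; apply: measure_digit0_le; rewrite expn_gt0.
Qed.

Definition ratpair (p : rat * rat) : set R := `]ratr p.1, ratr p.2[%classic.

Lemma open_ratpair (U : set R) x : open U -> U x ->
  exists p : rat * rat, ratpair p x /\ `[ratr p.1, ratr p.2] `<=` U.
Proof.
move=> oU Ux; have /nbhs_ballP[e /= e0 eU] : nbhs x U by apply: open_nbhs_nbhs.
have [p] := @rat_in_itvoo R (x - e) x ltac:(by rewrite ltrBlDr ltrDl).
rewrite in_itv /= => /andP[p1 p2].
have [q] := @rat_in_itvoo R x (x + e) ltac:(by rewrite ltrDl).
rewrite in_itv /= => /andP[q1 q2].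
exists (p, q); split; first by rewrite /ratpair /= in_itv /= p2.
move=> y /=; rewrite in_itv /= => /andP[py yq]; apply: eU.
rewrite /ball /= ltr_norml; apply/andP; split; lra.
Qed.

(* Baire category inside [K], with non-null in place of nonempty. *)
Lemma null_digits_exist (K : set R) g : compact K -> K `<=` `[0, 1] ->
  ~ mu.-negligible K -> K `&` coded_null g = set0 ->
  exists p m, ~ mu.-negligible (K `&` ratpair p) /\
    forall n, (m <= n)%N -> mu.-negligible (K `&` ratpair p `&` digit0 (2 ^ n.+1)%N (g n)).
Proof.
move=> cK K01 nK Kg; apply: contrapT => nex.
(* If the conclusion fails, some later digit set is non-null on [K] inside the current interval; a
   rational interval, non-null on [K], then has its closure inside both. *)
have step (pm : (rat * rat) * nat) : exists q : rat * rat,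
    ~ mu.-negligible (K `&` ratpair pm.1) ->
    ~ mu.-negligible (K `&` ratpair q) /\
    exists2 n, (pm.2 <= n)%N &
      `[ratr q.1, ratr q.2] `<=` ratpair pm.1 `&` digit0 (2 ^ n.+1)%N (g n).
  case: pm => p m /=; case: (pselect (mu.-negligible (K `&` ratpair p))) => [?|np].
    by exists p.
  apply: contrapT => nq; apply: nex; exists p, m; split=> // n mn.
  apply: contrapT => nneg.
  have oU : open (ratpair p `&` digit0 (2 ^ n.+1)%N (g n)).
    by apply: openI; [exact: interval_open | exact: digit0_open].
  (* Rational intervals with closure inside the open set cover it; were [K] null on each, it would
     be null on the union. *)
  apply: nneg; pose F k : set R := if unpickle k is Some q then
    if `[<`[ratr q.1, ratr q.2] `<=` ratpair p `&` digit0 (2 ^ n.+1)%N (g n)>]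
    then K `&` ratpair q else set0 else set0.
  apply: (@negligibleS _ _ _ mu (\bigcup_k F k)).
    move=> x [[Kx px] dx]; have [q [qx qsub]] := open_ratpair oU (conj px dx).
    exists (pickle q); [exact: Logic.I | rewrite /F pickleK]; case: asboolP => // _; by split.
  apply: negligible_bigcup => k; rewrite /F; case: unpickle => [q|]; last exact: negligible_set0.
  case: asboolP => [sub|_]; last exact: negligible_set0.
  by apply: contrapT => nnq; apply: nq; exists q => _; split=> //; exists n.
have [nx nxP] := choice step.
(* The starting interval []-1, 2[] contains all of [K]. *)
pose fix p i : rat * rat := if i is j.+1 then nx (p j, j) else (-1, 2)%R.
have pK i : ~ mu.-negligible (K `&` ratpair (p i)).
  elim: i => [|i IHi]; last by case: (nxP (p i, i) IHi).
  apply: contra_not nK; apply: negligibleS => x Kx; split=> //.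
  have := K01 _ Kx; rewrite /ratpair /= !in_itv /= rmorphN1 ratr_nat => /andP[x0 x1].
  by apply/andP; split; lra.
have pS i := (nxP (p i, i) (pK i)).2.
have psub i j : (i <= j)%N -> ratpair (p j) `<=` ratpair (p i).
  elim: j => [|j IHj]; first by rewrite leqn0 => /eqP->.
  rewrite leq_eqVlt => /orP[/eqP->//|]; rewrite ltnS => /IHj sub x xj.
  apply: sub; have [n _ H] := pS j; apply: (H x _).1.
  by move: xj; rewrite /ratpair /= !in_itv /= => /andP[/ltW-> /ltW->].
have yex i : exists y, K y /\ ratpair (p i) y.
  apply: contrapT => ny; apply: (pK i); suff -> : K `&` ratpair (p i) = set0 by exact: negligible_set0.
  by rewrite -subset0 => x Kx; apply: ny; exists x.
(* By compactness, points of [K] in the nested intervals cluster at a point of [K] lying in all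
   their closures, hence in [coded_null g]. *)
have [y yP] := choice yex.
have [|x [Kx xcl]] := cK (y @ \oo) _.
  by exists 0%N => // i _; case: (yP i).
have xp i : `[ratr (p i).1, ratr (p i).2]%classic x.
  rewrite [X in X x](closure_id _).1; last exact: interval_closed.
  move=> V nV; apply: xcl nV; exists i => // j /= le_ij.
  have := psub _ _ le_ij _ (yP j).2.
  by rewrite /ratpair /= !in_itv /= => /andP[/ltW-> /ltW->].
suff : (K `&` coded_null g) x by rewrite Kg.
split=> // m _; have [n mn H] := pS m.
by exists n => //; exact: (H _ (xp m.+1)).2.
Qed.

(** Fix a compact non-null [K] disjoint from [A]. If [coded_null g] lies in [A], it misses [K], so
    on some rational interval [K] is eventually null on the digit sets of [g]. Few digits have this
    property, and they form the slalom. *)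
Lemma negligible_slaloms (A : set R) : mu.-negligible A ->
  exists S : nat -> nat -> seq nat,
    (forall k n, size (S k n) <= 2 ^ n.+1 * 2 ^ n.+1)%N /\
    forall g, coded_null g `<=` A -> exists k, forall n, g n \in S k n.
Proof.
move=> [A0 [mA0 A00 AA0]].
pose I : set R := `[0, 1].
have mI : measurable I by exact: measurable_itv.
have I1 : mu I = 1%E by rewrite /mu lebesgue_measure_itv /= lte_fin ltr01 sube0.
have mX : measurable (I `\` A0) by exact: measurableD.
have [||K [cK KX muXK]] := @lebesgue_regularity_inner R (I `\` A0) 2^-1 mX.
- apply: (@le_lt_trans _ _ (mu I)); last by rewrite I1 ltry.
  by apply: le_measure; rewrite ?inE // => x [].
- by rewrite invr_gt0.
have mK : measurable K by exact: measurable_realfun.compact_measurable.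
have nK : ~ mu.-negligible K.
  move=> negK; have K0 : mu K = 0%E by exact: measure_negligible.
  have : (mu I < 1)%E; last by rewrite I1 ltxx.
  apply: (@le_lt_trans _ _ (mu A0 + (mu K + mu ((I `\` A0) `\` K)))%E).
    have mXK : measurable ((I `\` A0) `\` K) by exact: measurableD.
    have mKX : measurable (K `|` ((I `\` A0) `\` K)) by exact: measurableU.
    apply: (@le_trans _ _ (mu (A0 `|` (K `|` ((I `\` A0) `\` K))))%E).
      apply: le_measure; rewrite ?inE //; first exact: measurableU.
      move=> x Ix; case: (pselect (A0 x)) => [|nA]; first by left.
      by right; case: (pselect (K x)) => [|nKx]; [left | right].
    apply: le_trans (measureU2 _ mA0 mKX) _.
    by apply: leeD => //; exact: measureU2.
  rewrite [mu A0]A00 [mu K]K0 !add0e; apply: lt_trans muXK _.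
  by rewrite lte_fin invf_lt1 // ltr1n.
have K01 : K `<=` `[0, 1] by move=> x /KX[].
have mKp p : measurable (K `&` ratpair p).
  by apply: measurableI => //; exact: measurable_itv.
pose bad p n i := mu.-negligible (K `&` ratpair p `&` digit0 (2 ^ n.+1)%N i).
pose Sp p n : seq nat := xget [::]
  [set s : seq nat | (size s <= 2 ^ n.+1 * 2 ^ n.+1)%N /\ forall i, bad p n i -> i \in s].
(* A code carries a rational interval [p] and a prefix [q]: the prefix is copied, and beyond it all
   digits that are null on [p] are listed. *)
pose S k n : seq nat := if unpickle k is Some pq then
  let: (p, q) := (pq : (rat * rat) * seq nat) in
  if (n < size q)%N then [:: nth 0%N q n] else Sp p n else [::].
exists S; split=> [k n|g gA].
  rewrite /S; case: unpickle => [[p q]|] //; case: ifP => _.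
    by rewrite /= muln_gt0 expn_gt0.
  rewrite /Sp; case: xgetP => [s -> []|] //.
have [|p [m [np pm]]] := @null_digits_exist K g cK K01 nK.
  rewrite -subset0 => x [Kx gx]; case: (KX _ Kx) => _; apply.
  exact/AA0/gA.
have KpI : K `&` ratpair p `<=` `[0, 1] by move=> x [/K01].
have [c cP] := size_null_digits (mKp p) KpI np.
(* Nullness starts at [m]; from [c] on, the bound [c * 2 ^ n.+1] fits into the allowed width. *)
pose q := mkseq g (maxn m c).
exists (pickle (p, q)) => n; rewrite /S pickleK size_mkseq.
case: ltnP => [ltn|]; first by rewrite nth_mkseq // inE.
rewrite geq_max => /andP[mn cn].
rewrite /Sp; case: xgetP => [s -> [_]|nos]; first by apply; exact: pm.
have [|s szs sP] := @finite_enum (bad p n) (2 ^ n.+1 * 2 ^ n.+1)%N.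
  move=> s us sb; apply: leq_trans (cP _ s _ us sb) _; first by rewrite expn_gt0.
  rewrite leq_mul2r; apply/orP; right; apply: leq_trans cn _.
  by apply: ltnW; apply: leq_trans (ltn_expl n.+1 (isT : 1 < 2)%N).
by case: (nos s).
Qed.

End Slaloms.

(** * Set algebras and quasiranks *)

Definition band (a b : nat -> bool) : nat -> bool := fun x => a x && b x.
Definition bxor (a b : nat -> bool) : nat -> bool := fun x => a x (+) b x.
Definition bneg (a : nat -> bool) : nat -> bool := fun x => ~~ a x.

Definition set_algebra (B : (nat -> bool) -> Prop) : Prop :=
  [/\ B xpredT, forall a, B a -> B (bneg a),
      forall a b, B a -> B b -> B (band a b) &
      forall a b, B a -> B b -> B (bxor a b)].

Definition quasirank (B : (nat -> bool) -> Prop) (r : (nat -> bool) -> nat) : Prop :=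
  [/\ forall a, B a -> r (bneg a) <= (r a).+1,
      forall a b, B a -> B b -> r (band a b) <= (maxn (r a) (r b)).+1 &
      forall a b, B a -> B b -> r (bxor a b) <= (maxn (r a) (r b)).+1].

(** The name of the atom containing [x] in the algebra generated by the first [n] sets. *)
Definition code (e : nat -> nat -> bool) (n x : nat) : n.-tuple bool :=
  [tuple e i x | i < n].

(** Predicates act on plain sequences, so that [take] moves between levels without casts. *)
Definition algn (e : nat -> nat -> bool) (n : nat) (a : nat -> bool) : Prop :=
  exists C : seq bool -> bool, a = fun x => C (code e n x).

Lemma codeE e n x : code e n x = mkseq (e^~ x) n :> seq bool.
Proof.
apply: (@eq_from_nth _ false) => [|i]; rewrite size_tuple ?size_mkseq // => lt_in.
by rewrite -[i]/(val (Ordinal lt_in)) -tnth_nth tnth_mktuple nth_mkseq.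
Qed.

Lemma take_code e m n x : m <= n -> take m (code e n x) = code e m x.
Proof.
by move=> le_mn; rewrite !codeE /mkseq -map_take take_iota (minn_idPl le_mn).
Qed.

Lemma algn_le e m n a : m <= n -> algn e m a -> algn e n a.
Proof.
move=> le_mn [C ->]; exists (fun t => C (take m t)).
by apply/funext => x; rewrite take_code.
Qed.

Lemma algn_gen e i : algn e i.+1 (e i).
Proof.
exists (fun t => nth false t i); apply/funext => x.
by rewrite codeE nth_mkseq.
Qed.

Lemma algn_and e n a b : algn e n a -> algn e n b -> algn e n (band a b).
Proof. by case=> C -> [D ->]; exists (fun t => C t && D t). Qed.

Lemma algn_xor e n a b : algn e n a -> algn e n b -> algn e n (bxor a b).
Proof. by case=> C -> [D ->]; exists (fun t => C t (+) D t). Qed.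

Lemma algn_neg e n a : algn e n a -> algn e n (bneg a).
Proof. by case=> C ->; exists (fun t => ~~ C t). Qed.

Lemma algn_sub e n a x y :
  algn e n a -> code e n x = code e n y -> a x = a y.
Proof. by case=> C -> ->. Qed.

Lemma algn_subset (B : (nat -> bool) -> Prop) e n a :
  set_algebra B -> (forall i, B (e i)) -> algn e n a -> B a.
Proof.
move=> [B1 Bneg Band Bxor] Be [C ->].
have B0 : B xpred0 by have := Bneg _ B1; congr B; apply/funext.
elim: n C => [|n IHn] C.
  case E: (C [::]); [have := B1 | have := B0]; congr B; apply/funext => x;
    by rewrite -E; congr C; apply/esym/size0nil; rewrite size_tuple.
pose C1 b := fun t => C (rcons t b).
suff -> : (fun x => C (code e n.+1 x)) =
   bxor (band (e n) (fun x => C1 true (code e n x)))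
        (band (bneg (e n)) (fun x => C1 false (code e n x))).
  by apply: Bxor; apply: Band => //; apply: Bneg.
apply/funext => x; rewrite /bxor /band /bneg /C1.
have -> : tval (code e n.+1 x) = rcons (code e n x) (e n x).
  by rewrite !codeE /mkseq -{1}addn1 iotaD add0n map_cat cats1.
by case: (e n x); rewrite /= ?addbF.
Qed.

(** * Low-rank sets have small density *)

Section Density.
Variables (B : (nat -> bool) -> Prop) (r : (nat -> bool) -> nat).
Hypotheses (algB : set_algebra B) (qr : quasirank B r).
Variable e : nat -> nat -> bool.
Hypothesis Be : forall i, B (e i).

Definition low (n : nat) (c : nat -> bool) (K : nat) : {set {set n.-tuple bool}} :=
  finset (fun Q : {set n.-tuple bool} => r (fun x => (code e n x \in Q) && c x) <= K).

(* Each [Z] is a translate [Q + P t] of a low [Q] for at most two [t]: from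
   three translates one would recover [a t] as an intersection of two sums. *)
Lemma card_low (n : nat) (c : nat -> bool) (K M : nat) (a : 'I_M -> nat -> bool) :
  algn e n c -> (forall t, algn e n (a t)) ->
  (forall t x, a t x -> c x) ->
  (forall t s x, a t x -> a s x -> t = s) ->
  (forall t, K.+2 < r (a t)) ->
  #|low n c K| * M <= 2 * #|{set n.-tuple bool}|.
Proof.
move=> nc na ac adis ra.
have [C aC] := choice na.
pose P t : {set n.-tuple bool} := finset (fun u : n.-tuple bool => C t u).
pose D (Z Y : {set n.-tuple bool}) := finset (fun u => (u \in Z) (+) (u \in Y)).
have DK Y : involutive (D^~ Y).
  by move=> Z; apply/setP=> u; rewrite !inE -addbA addbb addbF.
(* Double counting: for each [t], translation by [P t] is an involution, so it preserves the number
   of low sets. *)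
have -> : #|low n c K| * M = \sum_Z \sum_(t < M) (D Z (P t) \in low n c K : nat).
  rewrite exchange_big /= -[X in _ * X]card_ord mulnC -sum_nat_const.
  apply: eq_bigr => t _; rewrite -sum1_card big_mkcond /=.
  rewrite (reindex_inj (inv_inj (DK (P t)))) /=.
  by apply: eq_bigr => Z _; case: ifP.
rewrite mulnC -sum_nat_const; apply: leq_sum => Z _.
have -> : \sum_(t < M) (D Z (P t) \in low n c K : nat) =
          #|[pred t | D Z (P t) \in low n c K]|.
  rewrite -sum1_card [RHS]big_mkcond /=; apply: eq_bigr => t _; rewrite !inE.
  by case: ifP.
rewrite leqNgt; apply/negP => /card_gt2P [t [s [q [[ht hs hq] [ts sq qt]]]]].
pose y : nat -> bool := fun x => (code e n x \in Z) && c x.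
have yn t' : (fun x => (code e n x \in D Z (P t')) && c x) = bxor y (a t').
  apply/funext => x; rewrite !inE /bxor /y aC; have := @ac t' x; rewrite aC.
  by case: (C t' _); case: (c x); case: (_ \in Z) => // /(_ isT).
have low_y t' : t' \in [pred t | D Z (P t) \in low n c K] -> r (bxor y (a t')) <= K.
  by rewrite !inE yn.
have ny : algn e n y.
  apply: (@algn_and _ _ (fun x => code e n x \in Z)) nc.
  pose S := [pred u : seq bool | [exists v in Z, val v == u]].
  exists S; apply/funext => x; apply/idP/exists_inP => [h|[v vZ /eqP]].
    by exists (code e n x).
  by move/val_inj <-.
have nBa b : algn e n b -> B b by apply: algn_subset.
have [_ rand rxor] := qr.
have nyt t' : algn e n (bxor y (a t')) by apply: algn_xor.
(* Adding two translates of [y] cancels [y] and leaves the disjoint union of [a t'] and [a s'], at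
   the cost of one unit of rank. *)
have E2 t' s' : t' != s' -> bxor (bxor y (a t')) (bxor y (a s')) = fun x => a t' x || a s' x.
  move=> ne; apply/funext => x; rewrite /bxor.
  have : ~~ (a t' x && a s' x) by apply/negP=> /andP[h1 h2]; rewrite (adis _ _ _ h1 h2) eqxx in ne.
  by case: (y x); case: (a t' x); case: (a s' x).
have R2 t' s' : t' \in [pred t | D Z (P t) \in low n c K] ->
   s' \in [pred t | D Z (P t) \in low n c K] -> t' != s' ->
   algn e n (fun x => a t' x || a s' x) /\ r (fun x => a t' x || a s' x) <= K.+1.
  move=> /low_y h1 /low_y h2 ne; rewrite -E2 //; split; first exact: algn_xor.
  apply: leq_trans (rxor _ _ (nBa _ (nyt _)) (nBa _ (nyt _))) _.
  by rewrite ltnS geq_max h1.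
have [n1 r1] := R2 t s ht hs ts.
have [n2 r2] : _ /\ _ := R2 t q ht hq (contra_neq esym qt).
have := ra t; apply/negP; rewrite -leqNgt.
(* The second unit of rank pays for this intersection, which contradicts [K.+2 < r (a t)]. *)
have -> : a t = band (fun x => a t x || a s x) (fun x => a t x || a q x).
  apply/funext => x; rewrite /band; case E: (a t x) => //=.
  by apply/esym/negP => /andP[h1 h2]; rewrite (adis _ _ _ h1 h2) eqxx in sq.
apply: leq_trans (rand _ _ (nBa _ n1) (nBa _ n2)) _.
by rewrite ltnS geq_max r1.
Qed.

End Density.

(** * Sets built from guesses *)

Section Construction.
Variable w : nat -> nat.
Variables T1 T2 : nat -> seq nat.

(** If the slalom [T1] captures [g], then [g (level j) <= level j.+1]: one slalom yields levels that
    grow as fast as needed. *)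
Fixpoint level (j : nat) : nat :=
  if j is i.+1 then maxn (\max_(k <- T1 (level i)) k) (level i).+1 else 0.

Definition guess (j : nat) :
    seq ((level j).-tuple bool * {set {set (level j).-tuple bool}}) :=
  pmap unpickle (T2 j).

Definition undecided (j : nat) : seq (seq bool) := [seq val s.1 | s <- guess j].

Definition decided_at (j : nat) (C : seq bool -> bool) : Prop :=
  forall t, C t -> (forall i, i < j -> take (level i) t \in undecided i) /\
                   take (level j) t \notin undecided j.

Definition trim (j : nat) (C : seq bool -> bool) (Q : {set (level j.+1).-tuple bool}) :
    {set (level j.+1).-tuple bool} :=
  finset (fun t => (t \in Q) && C (take (level j) t)).

Definition sparse (j : nat) (C : seq bool -> bool)
    (V : {set {set (level j.+1).-tuple bool}}) : Prop :=
  #|finset (fun Q => trim C Q \in V)| * (w j.+1).+1 <= #|{set (level j.+1).-tuple bool}|.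

Definition avoids (j : nat) (Q : {set (level j.+1).-tuple bool}) : Prop :=
  forall s, s \in guess j.+1 ->
    (exists2 C, decided_at j C & sparse C s.2) ->
    exists2 C, decided_at j C & trim C Q \notin s.2.

(** The choice depends only on the slaloms, neither on the rank nor on the branch, so the sets built
    from it can enter the tower beforehand. *)
Definition decision (j : nat) : {set (level j.+1).-tuple bool} :=
  xget (finset.set0 : {set (level j.+1).-tuple bool}) (fun Q => avoids Q).

(** The points whose code first leaves the guessed branches at level [j]; distinct levels give
    disjoint regions. *)
Definition region (e : nat -> nat -> bool) (j x : nat) : bool :=
  all (fun i => tval (code e (level i) x) \in undecided i) (iota 0 j) &&
  (tval (code e (level j) x) \notin undecided j).

(* Every [l] is [logn 2 j] for infinitely many [j]. *)
Definition new_set (e : nat -> nat -> bool) (l x : nat) : bool :=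
  `[<exists j, [&& region e j x, logn 2 j == l & code e (level j.+1) x \in decision j]>].

Lemma ltn_level j : level j < level j.+1.
Proof. exact: leq_maxr. Qed.

Lemma level_mono : {homo level : i j / i <= j}.
Proof.
move=> i j; elim: j => [|j IHj]; first by rewrite leqn0 => /eqP->.
rewrite leq_eqVlt => /orP[/eqP->//|]; rewrite ltnS => /IHj le_ij.
exact: leq_trans le_ij (ltnW (ltn_level j)).
Qed.

Lemma leq_level j : j <= level j.
Proof. by elim: j => // j IHj; apply: leq_ltn_trans IHj (ltn_level j). Qed.

Lemma level_ge_mem j k : k \in T1 (level j) -> k <= level j.+1.
Proof.
move=> kT; apply: leq_trans (leq_maxl _ _).
by rewrite (big_rem k kT) /= leq_maxl.
Qed.

Lemma region_inj e i j x : region e i x -> region e j x -> i = j.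
Proof.
move=> /andP[/allP ai ni] /andP[/allP aj nj].
case: (ltngtP i j) => // lt_ij.
  by have := aj i; rewrite mem_iota add0n => /(_ lt_ij); rewrite (negbTE ni).
by have := ai j; rewrite mem_iota add0n => /(_ lt_ij); rewrite (negbTE nj).
Qed.

Lemma new_set_disjoint e l l' x : new_set e l x -> new_set e l' x -> l = l'.
Proof.
move=> /asboolP[j /and3P[rj /eqP<- _]] /asboolP[i /and3P[ri /eqP<- _]].
by rewrite (region_inj rj ri).
Qed.

Lemma decided_region e j C x :
  decided_at j C -> C (code e (level j) x) -> region e j x.
Proof.
move=> dC /dC[h1]; rewrite take_code // => h2; apply/andP; split=> //.
apply/allP=> i; rewrite mem_iota add0n /= => lt_ij.
by have := h1 i lt_ij; rewrite take_code // level_mono // ltnW.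
Qed.

Lemma new_set_decided e j C x : decided_at j C -> C (code e (level j) x) ->
  new_set e (logn 2 j) x = (code e (level j.+1) x \in decision j).
Proof.
move=> dC Cx; have rj := decided_region dC Cx.
apply/asboolP/idP => [[i /and3P[ri _ h]]|h].
  by move: h; rewrite (region_inj ri rj).
by exists j; rewrite rj eqxx.
Qed.

(** There are at most [w j.+1] guesses, and each relevant one forbids at most a fraction
    [1 / (w j.+1).+1] of all subsets, so some subset is left over. *)
Lemma decisionP j : size (guess j.+1) <= w j.+1 -> avoids (decision j).
Proof.
move=> szg; apply: (@xgetPex {set (level j.+1).-tuple bool} finset.set0 (fun Q => avoids Q)).
pose X : finType := {set (level j.+1).-tuple bool}.
have Cex (s : (level j.+1).-tuple bool * {set X}) : exists C : seq bool -> bool,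
    (exists2 C, decided_at j C & sparse C s.2) ->
    decided_at j C /\ sparse C s.2.
  case: (pselect (exists2 C, decided_at j C & sparse C s.2)) => [[C d sp]|h]; last first.
    by exists xpred0 => /h.
  by exists C.
have [Cf CfP] := choice Cex.
pose bad s : {set X} :=
  if `[<exists2 C, decided_at j C & sparse C s.2>] then
    finset (fun Q => trim (Cf s) Q \in s.2) else finset.set0.
have cbad s : #|bad s| * (w j.+1).+1 <= #|X|.
  rewrite /bad; case: ifPn => [/asboolP/CfP[]//|_]; by rewrite cards0.
suff [Q Qn] : exists Q : X, forall s, s \in guess j.+1 -> Q \notin bad s.
  exists Q => s sg exC; have [dC _] := CfP s exC.
  exists (Cf s) => //; have := Qn s sg.
  by rewrite /bad ifT ?inE //; apply/asboolP.
apply: contrapT => nQ.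
have cover : #|X| <= \sum_(s <- guess j.+1) #|bad s|.
  have -> : \sum_(s <- guess j.+1) #|bad s| =
            \sum_(Q : X) \sum_(s <- guess j.+1) (Q \in bad s).
    rewrite exchange_big /=; apply: eq_bigr => s _.
    by rewrite -sum1_card big_mkcond /=; apply: eq_bigr => Q _; case: ifP.
  rewrite -sum1_card; apply: leq_sum => Q _.
  apply: contrapT => /negP; rewrite -ltnNge ltnS leqn0 => /eqP s0.
  apply: nQ; exists Q => s sg; move: s0; rewrite (big_rem s sg) /=.
  by case: (Q \in bad s).
have : #|X| * (w j.+1).+1 <= #|X| * w j.+1.
  apply: (@leq_trans ((\sum_(s <- guess j.+1) #|bad s|) * (w j.+1).+1)).
    by rewrite leq_mul2r cover orbT.
  rewrite big_distrl /=; apply: (@leq_trans (\sum_(s <- guess j.+1) #|X|)).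
    by apply: leq_sum => s _; exact: cbad.
  by rewrite big_const_seq iter_addn_0 count_predT leq_mul2l szg orbT.
rewrite leq_mul2l ltnn orbF; apply/negP; rewrite -lt0n; apply/card_gt0P.
by exists finset.set0.
Qed.

End Construction.

(** * One pair of slaloms defeats the low-rank sets *)

Section Capture.
Variable w : nat -> nat.
Variables (J : Type) (T : J -> nat -> seq nat).
Hypothesis size_T : forall a n, size (T a n) <= w n.
Hypothesis T_capture : forall g : nat -> nat, exists a, forall n, g n \in T a n.
Variables (r : (nat -> bool) -> nat) (e : nat -> nat -> bool) (z : nat -> bool).
Variable K : nat -> nat -> nat.

(* The true guess at level [j] is the branch [z] together with the table of
   low-rank sets; [captures] says that finite sets of wrong branches can be
   removed while keeping a piece on which low-rank sets are sparse. *)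
Definition captures : Prop := forall n j, exists N1, forall n1, N1 <= n1 -> n <= n1 ->
  exists N2, forall n2, N2 <= n2 -> n1 <= n2 -> forall W : seq (seq bool), size W <= w j ->
  exists C : seq bool -> bool,
    (forall t, C t -> take n t = mkseq z n /\ t \notin W) /\
    #|low r e n2 (fun x => C (code e n1 x)) (K n n1)| * (w j.+1).+1
      <= #|{set n2.-tuple bool}|.

(** The slalom [a1] makes the levels outgrow the thresholds of [captures], and [a2] contains the
    truth at every level. The decision evades all guesses with a sparse piece, in particular the
    true one. *)
Lemma capture_new_set : captures ->
  exists a1 a2, forall l m, exists n n1 (C : seq bool -> bool), [/\ m <= n, n <= n1 &
    K n n1 < r (fun x => new_set w (T a1) (T a2) e l x && C (code e n1 x))].
Proof.
move=> cap.
have [N1 N1P] := choice (fun p : nat * nat => cap p.1 p.2).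
have N2ex (p : nat * nat * nat) : exists N2,
  N1 p.1 <= p.2 -> p.1.1 <= p.2 -> forall n2, N2 <= n2 -> p.2 <= n2 ->
  forall W : seq (seq bool), size W <= w p.1.2 ->
  exists C : seq bool -> bool,
    (forall t, C t -> take p.1.1 t = mkseq z p.1.1 /\ t \notin W) /\
    #|low r e n2 (fun x => C (code e p.2 x)) (K p.1.1 p.2)| * (w p.1.2.+1).+1
      <= #|{set n2.-tuple bool}|.
  case: (pselect (N1 p.1 <= p.2 /\ p.1.1 <= p.2)) => [[h1 h2]|h].
    by have [N2 N2h] := N1P p.1 p.2 h1 h2; exists N2 => _ _.
  by exists 0 => h1 h2; case: h.
have [N2 N2P] := choice N2ex.
(* Maxima over all indices up to [m] suffice, because [j <= lev j]. *)
pose g m := maxn (\max_(j < m.+1) N1 (m, j.+1))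
                 (\max_(n < m.+1) \max_(j < m.+1) N2 ((n : nat, j.+1), m)).
have [a1 a1P] := T_capture g.
pose lev := level (T a1).
have gl j : g (lev j) <= lev j.+1 by apply: level_ge_mem; apply: a1P.
have gN1 m j : j <= m -> N1 (m, j.+1) <= g m.
  rewrite -ltnS => jm; apply: leq_trans (leq_maxl _ _).
  exact: (leq_bigmax (Ordinal jm)).
have gN2 n m j : n <= m -> j <= m -> N2 ((n, j.+1), m) <= g m.
  rewrite -(ltnS n) -(ltnS j) => nm jm; apply: leq_trans (leq_maxr _ _).
  apply: leq_trans (leq_bigmax (Ordinal nm)) => /=.
  exact: (leq_bigmax (Ordinal jm)).
(* The table at level [j] concerns the decision made at [j.-1], on a piece following [z] up to
   [lev j.-2]; this explains the two shifts. *)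
pose tr j : (lev j).-tuple bool * {set {set (lev j).-tuple bool}} :=
  ([tuple z i | i < lev j], low r e (lev j) xpredT (K (lev j.-2) (lev j.-1))).
have [a2 a2P] := T_capture (fun j => pickle (tr j)).
have tr_guess j : tr j \in guess (T a1) (T a2) j.
  by rewrite /guess mem_pmap; apply/mapP; exists (pickle (tr j)); rewrite // pickleK.
have tr1 j : tval (tr j).1 = mkseq z (lev j).
  apply: (@eq_from_nth _ false) => [|i]; rewrite size_tuple ?size_mkseq // => lt_in.
  by rewrite -[i]/(val (Ordinal lt_in)) -tnth_nth tnth_mktuple nth_mkseq.
have z_und j : mkseq z (lev j) \in undecided (T a1) (T a2) j.
  by rewrite -tr1; apply: (map_f (fun s => val s.1) (tr_guess j)).
have szg j : size (guess (T a1) (T a2) j) <= w j.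
  by rewrite size_pmap; apply: leq_trans (count_size _ _) (size_T _ _).
exists a1, a2 => l m.
(* The decision is taken at level [j.+1], which must have 2-adic valuation [l] and be large. *)
pose j := (2 ^ l * (2 * m).+1).-1.
have jE : j.+1 = 2 ^ l * (2 * m).+1 by rewrite prednK // muln_gt0 expn_gt0.
have lj : logn 2 j.+1 = l.
  rewrite jE lognM ?expn_gt0 // pfactorK // logn_coprime ?addn0 //.
  by rewrite coprime2n /= mul2n odd_double.
have mj : m <= j.
  rewrite -ltnS jE; apply: (@leq_trans (2 * m).+1).
    by rewrite ltnS leq_pmull.
  by rewrite leq_pmull // expn_gt0.
have lev_le : lev j <= lev j.+1 := ltnW (ltn_level (T a1) j).
have jl : j <= lev j := leq_level (T a1) j.
have h1 : N1 (lev j, j.+1) <= lev j.+1 by apply: leq_trans (gl j); apply: gN1.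
have h2 : N2 ((lev j, j.+1), lev j.+1) <= lev j.+2.
  by apply: leq_trans (gl j.+1); apply: gN2 => //; apply: leq_trans lev_le.
(* With [W] the branches guessed at level [j.+1], the piece [C] leaves the guesses there, while
   below it follows [z], which is always guessed; hence it is decided at [j.+1]. *)
have [|C [CP Cs]] := N2P ((lev j, j.+1), lev j.+1) h1 lev_le _ h2
   (ltnW (ltn_level (T a1) j.+1)) (undecided (T a1) (T a2) j.+1).
  by rewrite size_map; apply: szg.
have [|C' dC'] := decisionP (szg j.+2) (tr_guess j.+2).
  exists (fun t => C (take (lev j.+1) t)) => [t /CP[/= t1 t2]|].
    split=> // i; rewrite ltnS => le_ij.
    have li : lev i <= lev j by apply: level_mono.
    rewrite (take_takel _ lev_le) in t1.
    by rewrite -(take_takel _ li) t1 /mkseq -map_take take_iota (minn_idPl li) z_und.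
  apply: leq_trans Cs; rewrite leq_mul2r; apply/orP; right.
  apply: subset_leq_card; apply/fintype.subsetP => Q; rewrite !inE /=.
  rewrite (_ : (fun x => _ && xpredT x) =
     fun x => (code e (lev j.+2) x \in Q) && C (code e (lev j.+1) x)) //.
  apply/funext => x; rewrite inE andbT take_takel // take_code //.
  exact: ltnW (ltn_level (T a1) j.+1).
rewrite inE -ltnNge /= => KC.
exists (lev j), (lev j.+1), C'; split=> //; first exact: leq_trans mj jl.
move: KC; congr (_ < r _); apply/funext => x.
rewrite andbT inE take_code; last exact: ltnW (ltn_level (T a1) j.+1).
case E: (C' _); rewrite ?andbF // !andbT -lj.
by rewrite (new_set_decided w dC' E).
Qed.

End Capture.

(** * Quasiranks are bounded *)

Definition alg (e : nat -> nat -> bool) (a : nat -> bool) : Prop :=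
  exists n, algn e n a.

Lemma algn_pred e n (P : pred (seq bool)) : algn e n (fun x => P (code e n x)).
Proof. by exists P. Qed.

Lemma alg_and e a b : alg e a -> alg e b -> alg e (band a b).
Proof.
move=> [m ma] [n nb]; exists (maxn m n).
by apply: algn_and; apply: algn_le; [|exact: ma| |exact: nb]; rewrite (leq_maxl, leq_maxr).
Qed.

Lemma alg_xor e a b : alg e a -> alg e b -> alg e (bxor a b).
Proof.
move=> [m ma] [n nb]; exists (maxn m n).
by apply: algn_xor; apply: algn_le; [|exact: ma| |exact: nb]; rewrite (leq_maxl, leq_maxr).
Qed.

Lemma alg_neg e a : alg e a -> alg e (bneg a).
Proof. by move=> [n na]; exists n; apply: algn_neg. Qed.

Lemma alg_gen e i : alg e (e i).
Proof. by exists i.+1; apply: algn_gen. Qed.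

Lemma alg_common e M (f : 'I_M -> nat -> bool) : (forall t, alg e (f t)) ->
  exists n, forall t, algn e n (f t).
Proof.
move=> fa; have [n nP] := choice fa; exists (\max_t n t) => t.
exact: algn_le (leq_bigmax t) (nP t).
Qed.

Definition branch e (z : nat -> bool) n x : bool := tval (code e n x) == mkseq z n.

Lemma algn_branch e z n : algn e n (branch e z n).
Proof. exact: (@algn_pred e n (pred1 (mkseq z n))). Qed.

(** The branch plays the role of an ultrafilter: at each generator a side keeping [G] is
    selected. *)
Lemma branch_exists e (G : (nat -> bool) -> Prop) : G xpredT ->
  (forall a i, G a -> G (band a (e i)) \/ G (band a (bneg (e i)))) ->
  exists z, forall n, G (branch e z n).
Proof.
move=> GT Gs.
pose fix u n := if n is i.+1 then
  if `[<G (band (u i) (e i))>] then band (u i) (e i) else band (u i) (bneg (e i))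
  else xpredT.
pose z i := `[<G (band (u i) (e i))>].
have Gu n : G (u n).
  elim: n => [|n IHn] //=; case: asboolP => // nG.
  by case: (Gs _ n IHn).
exists z => n; suff <- : u n = branch e z n by [].
elim: n => [|n IHn]; first by apply/funext => x; rewrite /branch codeE.
apply/funext => x; rewrite /branch codeE /mkseq -{2 3}addn1 iotaD add0n !map_cat !cats1.
rewrite eqseq_rcons -/(mkseq (e^~ x) n) -codeE -/(mkseq z n) -/(branch e z n x).
rewrite /= -[`[<_>]]/(z n); case: (z n); rewrite /band /bneg IHn;
  by case: (branch _ _ _ _) => //=; case: (e n x).
Qed.

(* Distinct members of a disjoint family need distinct codes to meet [W]. *)
Lemma card_hit e n M (f : 'I_M -> nat -> bool) (W : seq (seq bool)) :
  (forall t, algn e n (f t)) -> (forall t s x, f t x -> f s x -> t = s) ->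
  #|[pred t | `[<exists2 x, f t x & tval (code e n x) \in W>]]| <= size W.
Proof.
move=> fn fdis; set A := [pred t | _].
have ex t : exists x, t \in A -> f t x && (tval (code e n x) \in W).
  case: (pselect (exists2 x, f t x & tval (code e n x) \in W)) => [[x ftx xW]|h].
    by exists x => _; apply/andP.
  by exists 0; rewrite inE => /h.
have [x xP] := choice ex.
rewrite cardE -(size_map (fun t => tval (code e n (x t)))); apply: uniq_leq_size.
  rewrite map_inj_in_uniq ?enum_uniq // => t s.
  rewrite !mem_enum => /xP/andP[ft _] /xP/andP[fs _] /val_inj E.
  by apply: (fdis t s (x t)) => //; rewrite (algn_sub (fn s) E).
by move=> y /mapP[t]; rewrite mem_enum => /xP/andP[_ h] ->.
Qed.

(** * New sets from unbounded quasiranks *)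

Section Unbounded.
Variables (B : (nat -> bool) -> Prop) (r : (nat -> bool) -> nat).
Hypotheses (algB : set_algebra B) (qr : quasirank B r).
Variable e : nat -> nat -> bool.
Hypothesis Be : forall i, B (e i).

Let alg_B a : alg e a -> B a.
Proof. by case=> n; apply: algn_subset. Qed.

Definition unb (a : nat -> bool) : Prop :=
  forall K, exists b, [/\ alg e b, forall x, b x -> a x & K < r b].

Lemma unb_split a s : alg e s -> unb a -> unb (band a s) \/ unb (band a (bneg s)).
Proof.
move=> sa ua; apply: contrapT => /not_orP[/existsNP[K1 h1] /existsNP[K2 h2]].
have [b [ba bsub]] := ua (maxn K1 K2).+1; apply/negP; rewrite -leqNgt.
have [_ _ rx] := qr.
have b1 : alg e (band b s) by apply: alg_and.
have b2 : alg e (band b (bneg s)) by apply: alg_and => //; apply: alg_neg.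
have -> : b = bxor (band b s) (band b (bneg s)).
  by apply/funext => x; rewrite /bxor /band /bneg; case: (b x); case: (s x).
apply: leq_trans (rx _ _ (alg_B b1) (alg_B b2)) _; rewrite ltnS geq_max !leq_max.
apply/andP; split; apply/orP; [left|right]; rewrite leqNgt; apply/negP => h.
  by apply: h1; exists (band b s); split=> // x /andP[/bsub ax sx]; apply/andP.
by apply: h2; exists (band b (bneg s)); split=> // x /andP[/bsub ax sx]; apply/andP.
Qed.

(** A piece of large rank is split off so that the rest stays unbounded. If only [b] itself is
    unbounded, its complement in [a] is split off instead; that has large rank because [b] is the
    sum of [a] and this complement. *)
Lemma unb_disjoint M K a : alg e a -> unb a -> exists f : 'I_M -> nat -> bool,
  [/\ forall t, alg e (f t), forall t x, f t x -> a x,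
      forall t s x, f t x -> f s x -> t = s & forall t, K < r (f t)].
Proof.
move=> aa ua; suff [f [f1 f2 f3 f4]] : exists f : nat -> nat -> bool,
  [/\ forall t, t < M -> alg e (f t), forall t x, t < M -> f t x -> a x,
      forall t s x, t < M -> s < M -> f t x -> f s x -> t = s &
      forall t, t < M -> K < r (f t)].
  exists (fun t => f t); split=> [t|t x|t s x ft fs|t]; [exact: f1|exact: f2| |exact: f4].
  by apply: val_inj; apply: f3 ft fs.
elim: M a aa ua => [|M IHM] a aa ua; first by exists (fun _ => xpredT).
have [b [ba bsub rb]] := ua (maxn (r a) K).+1.
suff [b' [b'a b'sub rb' ub']] : exists b', [/\ alg e b', forall x, b' x -> a x,
    K < r b' & unb (band a (bneg b'))].
  have [|f [f1 f2 f3 f4]] := IHM _ _ ub'; first by apply: alg_and => //; apply: alg_neg.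
  exists (fun t => if t is i.+1 then f i else b'); split.
  - by case.
  - by case=> [|t] x => [_ /b'sub|] //; rewrite ltnS => /f2 h /h /andP[].
  - case=> [|t] [|s] x //; rewrite !ltnS.
    + by move=> _ sM b'x /(f2 _ _ sM)/andP[_]; rewrite /bneg b'x.
    + by move=> tM _ /(f2 _ _ tM)/andP[_ nb] b'x; rewrite /bneg b'x in nb.
    + by move=> tM sM ft fs; congr _.+1; apply: f3 ft fs.
  - by case.
case: (unb_split ba ua) => ub; last first.
  by exists b; split=> //; apply: leq_ltn_trans rb; rewrite leqW // leq_maxr.
exists (band a (bneg b)); split.
- by apply: alg_and => //; apply: alg_neg.
- by move=> x /andP[].
- rewrite ltnNge; apply/negP => rK; move: rb; apply/negP; rewrite -leqNgt.
  have -> : b = bxor a (band a (bneg b)).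
    apply/funext => x; rewrite /bxor /band /bneg; have := bsub x.
    by case: (b x) => [/(_ isT)->|_] //; case: (a x).
  have [_ _ rx] := qr.
  apply: leq_trans (rx _ _ (alg_B aa) _) _.
    by apply: alg_B; apply: alg_and => //; apply: alg_neg.
  by rewrite ltnS geq_max leq_maxl leq_max rK orbT.
- suff <- : band a b = band a (bneg (band a (bneg b))) by [].
  by apply/funext => x; rewrite /band /bneg; case: (a x); case: (b x).
Qed.

Lemma card_low_half n c K m (I : finType) (f : I -> nat -> bool) :
  2 * m <= #|I| -> algn e n c -> (forall t, algn e n (f t)) ->
  (forall t x, f t x -> c x) -> (forall t s x, f t x -> f s x -> t = s) ->
  (forall t, K.+2 < r (f t)) ->
  #|low r e n c K| * m <= #|{set n.-tuple bool}|.
Proof.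
move=> mI cn fn fc fdis fr.
rewrite -(leq_pmul2l (isT : 0 < 2)) mulnCA.
apply: leq_trans (_ : #|low r e n c K| * #|I| <= _); first by rewrite leq_mul2l mI orbT.
apply: (card_low algB qr Be (a := fun t => f (enum_val t))) => //.
- by move=> t x; apply: fc.
- by move=> t s x ft fs; apply: enum_val_inj; apply: fdis ft fs.
Qed.

Variables (w : nat -> nat) (J : Type) (T : J -> nat -> seq nat).
Hypothesis size_T : forall a n, size (T a n) <= w n.
Hypothesis T_capture : forall g : nat -> nat, exists a, forall n, g n \in T a n.

Lemma unb_new_set : unb xpredT -> exists a1 a2, forall l m, exists2 c,
  alg e c & m < r (fun x => new_set w (T a1) (T a2) e l x && c x).
Proof.
move=> uT; have [z uz] := branch_exists uT (fun a i => @unb_split a _ (alg_gen e i)).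
have [|a1 [a2 aP]] := @capture_new_set w J T size_T T_capture r e z (fun n _ => n).
  (* The set [W] meets at most [w j] of the disjoint pieces; the others still number
     [2 * (w j.+1).+1], as the density bound asks. The rank [n.+2] is the loss in [card_low]. *)
  move=> n j; pose M := w j + 2 * (w j.+1).+1.
  have bra : alg e (branch e z n) by exists n; apply: algn_branch.
  have [f [f1 f2 f3 f4]] := unb_disjoint M n.+2 bra (uz n).
  have [N1 fN1] := alg_common f1; exists N1 => n1 le1 le_n.
  have fn1 t : algn e n1 (f t) by apply: algn_le (fN1 t).
  exists n1 => n2 le2 _ W szW.
  pose C t := (take n t == mkseq z n) && (t \notin W).
  exists C; split=> [t /andP[/eqP]|] //.
  have := card_hit W fn1 f3; set A := [pred t | _] => cA.
  have cA' : 2 * (w j.+1).+1 <= #|predC A|.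
    by rewrite -(leq_add2l #|A|) cardC card_ord leq_add2r (leq_trans cA).
  have nA (t : {t | predC A t}) x : f (val t) x -> tval (code e n1 x) \notin W.
    by move=> ftx; case: t ftx => t /= nt ftx; apply/negP => xW; case/negP: nt;
       apply/asboolP; exists x.
  apply: (@card_low_half _ _ _ _ {t | predC A t} (fun t => f (val t))).
  - by rewrite card_sig.
  - exact: algn_le le2 (algn_pred _ _ _).
  - by move=> t; apply: algn_le le2 _.
  - move=> t x ftx; rewrite /C take_code // (nA _ _ ftx) andbT.
    by have := f2 _ _ ftx.
  - by move=> t s x ft fs; apply: val_inj; apply: f3 ft fs.
  - by move=> t; apply: f4.
exists a1, a2 => l m; have [n [n1 [C [mn _ h]]]] := aP l m.
by exists (fun x => C (code e n1 x)); [exists n1; exists C | apply: leq_ltn_trans mn h].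
Qed.

(** The threshold now exceeds [R n1], the largest rank of a set determined at level [n1]. A set
    whose trace on such a set has rank beyond the threshold has large rank itself, and if it
    belonged to [B] its rank would exceed itself. *)
Lemma unb_family_new_set (c : nat -> nat -> bool) :
  (forall l, alg e (c l)) -> (forall l k x, c l x -> c k x -> l = k) ->
  (forall l, unb (c l)) ->
  exists a1 a2, ~ B (new_set w (T a1) (T a2) e 0).
Proof.
move=> ca cdis uc.
(* Infinitely many members of the family stay unbounded inside [a]; the branch [z] keeps this
   property. *)
pose G a := forall m, exists2 l, m <= l & unb (band (c l) a).
have GT : G xpredT.
  move=> m; exists m => //; have -> // : band (c m) xpredT = c m.
  by apply/funext => x; rewrite /band andbT.
have Gs a i : G a -> G (band a (e i)) \/ G (band a (bneg (e i))).
  move=> Ga; apply: contrapT => /not_orP[/existsNP[m1 h1] /existsNP[m2 h2]].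
  have [l lm ul] := Ga (maxn m1 m2).
  have bA (s : nat -> bool) : band (band (c l) a) s = band (c l) (band a s).
    by apply/funext => x; rewrite /band andbA.
  have [] := unb_split (alg_gen e i) ul; rewrite bA => u'.
    by apply: h1; exists l => //; apply: leq_trans (leq_maxl _ _) lm.
  by apply: h2; exists l => //; apply: leq_trans (leq_maxr _ _) lm.
have [z Gz] := branch_exists GT Gs.
pose R n1 := \max_(Q : {set n1.-tuple bool}) r (fun x => code e n1 x \in Q).
have rR n1 (C : seq bool -> bool) : r (fun x => C (code e n1 x)) <= R n1.
  have -> : (fun x => C (code e n1 x)) =
    fun x => code e n1 x \in (finset (fun t => C (tval t)) : {set n1.-tuple bool}).
    by apply/funext => x; rewrite inE.
  exact: (@leq_bigmax _ (fun Q : {set n1.-tuple bool} => r (fun x => code e n1 x \in Q))).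
have [|a1 [a2 aP]] := @capture_new_set w J T size_T T_capture r e z
    (fun n n1 => (maxn n (R n1)).+1); last first.
  exists a1, a2 => Bb; have [n [n1 [C [mn _]]]] := aP 0 (r (new_set w (T a1) (T a2) e 0)).
  apply/negP; rewrite -leqNgt; have [_ ra _] := qr.
  apply: leq_trans (ra _ (fun x => C (code e n1 x)) Bb _) _.
    by apply: alg_B; exists n1; exists C.
  by rewrite ltnS geq_max !leq_max mn rR orbT.
move=> n j.
have hex m : exists l, m <= l /\ unb (band (c l) (branch e z n)).
  by have [l ml ul] := Gz n m; exists l.
have [h hP] := choice hex.
pose fix l t := if t is i.+1 then h (l i).+1 else h 0.
have lS t : l t < l t.+1 by case: (hP (l t).+1).
have l_inj : injective l.
  have mono := homo_ltn (fun y x z => @ltn_trans y x z) lS.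
  by move=> s t E; case: (ltngtP s t) => // /mono; rewrite E ltnn.
(* One more unbounded piece than [W] can meet. Large subpieces are found only after [n1], since
   their rank must exceed [R n1]. *)
pose M := (w j).+1.
pose F (t : 'I_M) := band (c (l t)) (branch e z n).
have Fu t : unb (F t).
  by rewrite /F; case: (nat_of_ord t) => [|i]; [case: (hP 0) | case: (hP (l i).+1)].
have Fa t : alg e (F t) by apply: alg_and; [apply: ca | exists n; apply: algn_branch].
have Fdis t s x : F t x -> F s x -> t = s.
  by move=> /andP[ct _] /andP[cs _]; apply: val_inj; apply: l_inj; apply: cdis ct cs.
have [N1 FN1] := alg_common Fa; exists N1 => n1 le1 le_n.
have Fn1 t : algn e n1 (F t) by apply: algn_le (FN1 t).
set K := (maxn n (R n1)).+1.
have fex t := unb_disjoint (2 * (w j.+1).+1) K.+2 (Fa t) (Fu t).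
have [f fP] := choice fex.
have [N2 fN2] : exists N2, forall t s, algn e N2 (f t s).
  have ex t : exists N, forall s, algn e N (f t s).
    by apply: alg_common; case: (fP t).
  have [N NP] := choice ex; exists (\max_t N t) => t s.
  exact: algn_le (leq_bigmax t) (NP t s).
exists N2 => n2 le2 le12 W szW.
have := card_hit W Fn1 Fdis; set A := [pred t | _] => cA.
have [t tA] : exists t, t \notin A.
  apply/existsP; rewrite -negb_forall; apply/negP => /forallP allA.
  have : #|A| = M by rewrite -[RHS]card_ord; apply: eq_card => t; rewrite allA.
  by move=> E; move: (leq_trans cA szW); rewrite E ltnn.
exists (fun u => `[<exists2 x, tval (code e n1 x) = u & F t x>]); split.
  move=> u /asboolP[x <- Fx]; split.
    by rewrite take_code //; case/andP: Fx => _ /eqP.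
  by apply/negP => xW; case/negP: tA; apply/asboolP; exists x.
have -> : (fun x => `[<exists2 y, tval (code e n1 y) = code e n1 x & F t y>]) = F t.
  apply/funext => x; apply/asboolP/idP => [[y /val_inj E Fy]|Fx]; last by exists x.
  by rewrite -(algn_sub (Fn1 t) E).
have [f1 f2 f3 f4] := fP t.
apply: (@card_low_half _ _ _ _ _ (f t)) => //.
- by rewrite card_ord.
- exact: algn_le le12 (Fn1 t).
- by move=> s; apply: algn_le le2 _.
Qed.

End Unbounded.

(** * Boundedness of all quasiranks *)

Section BoundedRank.
Variables (B : (nat -> bool) -> Prop) (w : nat -> nat).
Variables (J : Type) (T : J -> nat -> seq nat).
Hypothesis algB : set_algebra B.
Hypothesis size_T : forall a n, size (T a n) <= w n.
Hypothesis T_capture : forall g : nat -> nat, exists a, forall n, g n \in T a n.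
Hypothesis B_rich : forall c : nat -> nat -> bool, (forall n, B (c n)) ->
  exists e, [/\ forall i, B (e i), forall n, alg e (c n) &
    forall a1 a2 l, B (new_set w (T a1) (T a2) e l)].

Theorem quasirank_bounded (r : (nat -> bool) -> nat) : quasirank B r ->
  exists K, forall b, B b -> r b <= K.
Proof.
move=> qr; apply: contrapT => nK.
have ex K : exists b, B b /\ K < r b.
  apply: contrapT => nb; apply: nK; exists K => b Bb; rewrite leqNgt.
  by apply/negP => Kb; apply: nb; exists b.
have [c cP] := choice ex.
(* First round: a countable algebra containing sets of every rank yields disjoint new sets [b l],
   each unbounded in [B]. *)
have [e [Be ec Bnew]] := B_rich (fun n => (cP n).1).
have uT : unb r e xpredT.
  by move=> K; exists (c K); split=> //; case: (cP K).
have [a1 [a2 newP]] := unb_new_set algB qr Be size_T T_capture uT.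
pose b l := new_set w (T a1) (T a2) e l.
have ex2 (p : nat * nat) := cid2 (newP p.1 p.2).
pose d p := projT1 (ex2 p).
have da p : alg e (d p) by rewrite /d; case: (ex2 p).
have dr p : p.2 < r (band (b p.1) (d p)) by rewrite /d; case: (ex2 p).
(* Second round: one sequence lists the sets [b l] and the traces witnessing their unboundedness, so
   that a single later algebra contains them all. *)
pose s n : nat -> bool := if unpickle n is Some i then
  match i : nat + nat * nat with inl l => b l | inr p => band (b p.1) (d p) end
  else xpredT.
have [B1 _ Band _] := algB.
have Bb l : B (b l) by apply: Bnew.
have Bs n : B (s n).
  rewrite /s; case: unpickle => [[l|p]|] //; apply: Band => //.
  by case: (da p) => k; apply: algn_subset.
have [e' [Be' es Bnew']] := B_rich Bs.
have al i : alg e' (match i : nat + nat * nat with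
     inl l => b l | inr p => band (b p.1) (d p) end).
  by have := es (pickle i); rewrite /s pickleK.
have [||| a1' [a2' []]] := unb_family_new_set algB qr Be' size_T T_capture (c := b).
- by move=> l; apply: (al (inl l)).
- by move=> l k x; apply: new_set_disjoint.
- move=> l K; exists (band (b l) (d (l, K))); split.
  + exact: (al (inr (l, K))).
  + by move=> x /andP[].
  + exact: (dr (l, K)).
- exact: Bnew'.
Qed.

End BoundedRank.

(** * Towers of length omega_1 *)

Section Omega1.
Variables (I : Type) (lt : I -> I -> Prop).
Hypothesis lt_irr : forall x, ~ lt x x.
Hypothesis lt_trans : forall x y z, lt x y -> lt y z -> lt x z.
Hypothesis lt_total : forall x y, x = y \/ lt x y \/ lt y x.
Hypothesis lt_wf : well_founded lt.
Hypothesis lt_countable : forall x, countableT {y : I | lt y x}.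

Lemma initial_segment_enum x : exists en : nat -> option {y : I | lt y x},
  forall y, exists n, en n = Some y.
Proof.
have [f f_inj] := lt_countable x.
have ex n : exists o : option {y : I | lt y x}, forall y, f y = n -> o = Some y.
  case: (pselect (exists y, f y = n)) => [[y fy]|ny].
    by exists (Some y) => y'; rewrite -fy => /f_inj ->.
  by exists None => y fy; case: ny; exists y.
have [en enP] := choice ex.
by exists en => y; exists (f y); apply: enP.
Qed.

(** Regularity of omega_1: an unbounded sequence would make [I] a countable union of countable
    initial segments. *)
Lemma sequence_bounded : ~ countableT I -> forall f : nat -> I,
  exists x, forall n, lt (f n) x.
Proof.
move=> ncI f; apply: contrapT => nb; apply: ncI.
have ex x : exists n, ~ lt (f n) x.
  by apply: contrapT => nx; apply: nb; exists x => n; apply: contrapT => h; apply: nx; exists n.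
have [n nP] := choice ex.
pose g n := sval (cid (lt_countable (f n))).
have gP n : injective (g n) := svalP (cid (lt_countable (f n))).
(* The value [0] is reserved for [x = f (n x)], successors for [x] strictly below. *)
pose h x : nat := if pselect (lt x (f (n x))) is left p then (g (n x) (exist _ x p)).+1 else 0.
exists (fun x => pickle (n x, h x)) => x y hxy; have [E] := pcan_inj pickleK hxy.
have nx := @nP x; have ny := @nP y; have tx := lt_total x (f (n x)); have ty := lt_total y (f (n y)).
rewrite /h -E; rewrite -E in ty.
case: pselect => [px|npx]; case: pselect => [py|npy] //.
  by move=> [/gP/(congr1 sval)].
move=> _; case: tx => [xE|[/npx|/nx]] //; case: ty => [yE|[/npy|]] //.
  by rewrite xE yE.
by rewrite E => /ny.
Qed.

(** Well-founded recursion: the countably many tuples [(y, i, j, n)] below [x] are enumerated into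
    the one sequence [E x]. *)
Lemma tower_exists (X : Type) (op : (nat -> X) -> I -> I -> nat -> X) : X ->
  exists E : I -> nat -> X, forall x y i j n, lt y x -> lt i x -> lt j x ->
    exists k, E x k = op (E y) i j n.
Proof.
move=> x0; pose en x := sval (cid (initial_segment_enum x)).
have enP x : forall y, exists n, en x n = Some y := svalP (cid (initial_segment_enum x)).
pose F x (E : forall y, lt y x -> nat -> X) (k : nat) : X :=
  if unpickle k is Some (((a, b), c), n) then
    if (en x a, en x b, en x c) is (Some y, Some i, Some j)
    then op (E (sval y) (svalP y)) (sval i) (sval j) n else x0
  else x0.
pose E := Fix lt_wf (fun _ => nat -> X) F.
have EE x : E x = F x (fun y _ => E y).
  rewrite /E Fix_eq // => z f g fg; congr F.
  by apply: functional_extensionality_dep => y; apply: functional_extensionality_dep => p.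
exists E => x y i j n xy xi xj.
have [a ya] := enP x (exist _ y xy); have [b ib] := enP x (exist _ i xi).
have [c jc] := enP x (exist _ j xj).
by exists (pickle (a, b, c, n)); rewrite EE /F pickleK ya ib jc.
Qed.

(** The lexicographic order on [I * nat] is pulled back along [g]; its initial segments use
    countably many first coordinates. *)
Lemma card_aleph1_inj (T : Type) (g : T -> I * nat) :
  injective g -> ~ countableT T -> card_aleph1 T.
Proof.
move=> g_inj ncT; split=> //.
pose lex (p q : I * nat) := lt p.1 q.1 \/ p.1 = q.1 /\ p.2 < q.2.
have lex_wf : well_founded lex.
  move=> [x n]; elim/(well_founded_ind lt_wf): x n => x IHx n.
  elim/ltn_ind: n => n IHn; constructor => -[y m] [/= /IHx //|[/= -> /IHn]] //.
exists (fun s t => lex (g s) (g t)); split; [|split; [|split; [|split]]].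
- by move=> s [/lt_irr|[_]] //; rewrite ltnn.
- move=> s t u [st|[st1 st2]] [tu|[tu1 tu2]].
  + by left; apply: lt_trans st tu.
  + by left; rewrite -tu1.
  + by left; rewrite st1.
  + by right; rewrite st1 tu1; split=> //; apply: ltn_trans st2 tu2.
- move=> s t; case: (lt_total (g s).1 (g t).1) => [E|[h|h]]; last 2 first.
  + by right; left; left.
  + by right; right; left.
  case: (ltngtP (g s).2 (g t).2) => h.
  + by right; left; right.
  + by right; right; right.
  + by left; apply: g_inj; case: (g s) (g t) E h => [? ?] [? ?] /= -> ->.
- move=> t; move: {2}(g t) (erefl (g t)) => p; elim/(well_founded_ind lex_wf): p t => p IHp t gt.
  by constructor => s gs; apply: (IHp (g s)) => //; rewrite -gt.
- move=> t; have [f f_inj] := lt_countable (g t).1.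
  pose h (s : {s | lex (g s) (g t)}) : option nat :=
    if pselect (lt (g (sval s)).1 (g t).1) is left p then Some (f (exist _ _ p)) else None.
  exists (fun s => pickle (h s, (g (sval s)).2)) => -[s sl] [s' sl'] hss; case: {hss}(pcan_inj pickleK hss).
  rewrite /h /=; case: pselect => p; case: pselect => p' //.
    move=> [/f_inj/(congr1 sval)/= E1 E2].
    apply: eq_exist; apply: g_inj.
    by move: E1 E2; case: (g s) (g s') => [? ?] [? ?] /= -> ->.
  move=> _ E2; apply: eq_exist; apply: g_inj.
  case: sl => [/p|[E1 _]] //; case: sl' => [/p'|[E1' _]] //.
  by move: E1 E2; rewrite -E1'; case: (g s) (g s') => [? ?] [? ?] /= -> ->.
Qed.

End Omega1.

(** * Diagonal sets and functions measurable at a finite level *)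

Definition diagonal (e : nat -> nat -> bool) (x : nat) : bool :=
  if unpickle x is Some u then
    let: existT n Q := (u : {n : nat & {set n.-tuple bool}}) in code e n x \notin Q
  else true.

Lemma diagonal_notin e : ~ alg e (diagonal e).
Proof.
move=> [n [C diagC]]; pose Q : {set n.-tuple bool} := finset (fun t => C (tval t)).
have := congr1 (fun f => f (pickle (existT (fun n => {set n.-tuple bool}) n Q))) diagC.
by rewrite /diagonal pickleK inE; case: (C _).
Qed.

Definition adapted (A : Type) (e : nat -> nat -> bool) (f : nat -> A) : Prop :=
  exists n (C : seq bool -> A), f = fun x => C (code e n x).

Lemma code_factor e e' n : (forall i, alg e (e' i)) ->
  exists m (G : seq bool -> seq bool), forall x, tval (code e' n x) = G (code e m x).
Proof.
move=> ee'; elim: n => [|n [m [G mG]]].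
  by exists 0, (fun _ => [::]) => x; rewrite codeE.
have [k [C eC]] := ee' n; exists (maxn m k).
exists (fun u => rcons (G (take m u)) (C (take k u))) => x.
rewrite !take_code ?leq_maxl ?leq_maxr // -mG codeE /mkseq -addn1 iotaD add0n map_cat.
by rewrite cats1 -/(mkseq (e'^~ x) n) -codeE eC.
Qed.

Lemma adapted_trans (A : Type) e e' (f : nat -> A) :
  (forall i, alg e (e' i)) -> adapted e' f -> adapted e f.
Proof.
move=> ee' [n [C ->]]; have [m [G mG]] := code_factor n ee'.
by exists m, (fun u => C (G u)); apply/funext => x; rewrite mG.
Qed.

Lemma adapted2 (A A' A'' : Type) e (op : A -> A' -> A'') f g :
  adapted e f -> adapted e g -> adapted e (fun x => op (f x) (g x)).
Proof.
move=> [n [C ->]] [m [D ->]].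
exists (maxn n m), (fun u => op (C (take n u)) (D (take m u))).
by apply/funext => x; rewrite !take_code ?leq_maxl ?leq_maxr.
Qed.

Lemma adapted1 (A A' : Type) e (op : A -> A') f :
  adapted e f -> adapted e (fun x => op (f x)).
Proof. by move=> [n [C ->]]; exists n, (fun u => op (C u)). Qed.

(** * The tower of countable algebras and its group *)

Section Tower.
Variables (I : Type) (lt : I -> I -> Prop) (w : nat -> nat).
Variable T : I * nat -> nat -> seq nat.

(** Three tasks share one index: keeping the old generators, adding new sets for pairs of slaloms,
    and adding a diagonal set so that the tower never stabilizes. *)
Definition tower_op (e : nat -> nat -> bool) (i j : I) (n : nat) : nat -> bool :=
  match (unpickle n : option (nat + nat * nat * nat + unit)) with
  | Some (inl (inl k)) => e k
  | Some (inl (inr (k, k', l))) => new_set w (T (i, k)) (T (j, k')) e l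
  | Some (inr _) => diagonal e
  | None => xpred0
  end.

Variable E : I -> nat -> nat -> bool.
Hypothesis EP : forall x y i j n, lt y x -> lt i x -> lt j x ->
  exists k, E x k = tower_op (E y) i j n.
Hypothesis ubound : forall f : nat -> I, exists x, forall n, lt (f n) x.

Definition tower_set (b : nat -> bool) : Prop := exists x, alg (E x) b.

Lemma tower_le x y i : lt y x -> alg (E x) (E y i).
Proof.
move=> yx; have [k] := EP (pickle (inl (inl i) : nat + nat * nat * nat + unit)) yx yx yx.
by rewrite /tower_op pickleK => <-; apply: alg_gen.
Qed.

Lemma adapted_le A x y (f : nat -> A) : lt y x -> adapted (E y) f -> adapted (E x) f.
Proof. by move=> yx; apply: adapted_trans => i; apply: tower_le. Qed.

Lemma ubound2 x y : exists z, lt x z /\ lt y z.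
Proof.
have [z zP] := ubound (fun n => if n is 0 then x else y).
by exists z; split; [exact: (zP 0) | exact: (zP 1)].
Qed.

Variable x0 : I.

Lemma tower_algebra : set_algebra tower_set.
Proof.
have up2 (op : bool -> bool -> bool) a b : tower_set a -> tower_set b ->
    tower_set (fun x => op (a x) (b x)).
  move=> [x xa] [y yb]; have [z [xz yz]] := ubound2 x y.
  by exists z; apply: (adapted2 op); [apply: adapted_le xz xa | apply: adapted_le yz yb].
split.
- by exists x0, 0, xpredT.
- by move=> a [x xa]; exists x; apply: alg_neg.
- by move=> a b; apply: up2.
- by move=> a b; apply: up2.
Qed.

Lemma tower_rich (c : nat -> nat -> bool) : (forall n, tower_set (c n)) ->
  exists e, [/\ forall i, tower_set (e i), forall n, alg e (c n) &
    forall a1 a2 l, tower_set (new_set w (T a1) (T a2) e l)].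
Proof.
move=> cB; have [f fP] := choice cB; have [x fx] := ubound f.
exists (E x); split=> [i|n|[i k] [j k'] l].
- by exists x; apply: alg_gen.
- exact: adapted_le (fx n) (fP n).
have [z zP] := ubound (fun n => nth x [:: x; i; j] n).
have [m Ez] := EP (pickle (inl (inr (k, k', l)) : nat + nat * nat * nat + unit))
  (zP 0) (zP 1) (zP 2).
by exists z; move: Ez; rewrite /tower_op pickleK => <-; apply: alg_gen.
Qed.

Lemma tower_diagonal x : exists b, tower_set b /\ ~ alg (E x) b.
Proof.
exists (diagonal (E x)); split; last exact: diagonal_notin.
have [z zP] := ubound (fun=> x); exists z.
have [m] := EP (pickle (inr tt : nat + nat * nat * nat + unit)) (zP 0) (zP 0) (zP 0).
by rewrite /tower_op pickleK => <-; apply: alg_gen.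
Qed.

Section Power.
Variables (gT : finGroupType) (H : {group gT}).
Local Open Scope group_scope.

Definition tower_power (f : nat -> gT) : Prop :=
  (forall n, f n \in H) /\ exists x, adapted (E x) f.

Lemma tower_power_subgroup : subgroup_of_power H tower_power.
Proof.
split; first by move=> f [].
split; first by split=> [n|]; [exact: group1 | exists x0, 0%N, (fun=> 1)].
split=> [f g [fH [x xf]] [gH [y yg]]|f [fH [x xf]]].
  split=> [n|]; first by rewrite groupM.
  have [z [xz yz]] := ubound2 x y; exists z.
  by apply: (adapted2 (fun a b : gT => a * b));
     [apply: adapted_le xz xf | apply: adapted_le yz yg].
split=> [n|]; first by rewrite groupV.
by exists x; apply: (adapted1 (fun a : gT => a^-1)).
Qed.

Definition step (h : gT) (b : nat -> bool) : nat -> gT := fun x => if b x then h else 1.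

Lemma step_tower_power h b : h \in H -> tower_set b -> tower_power (step h b).
Proof.
move=> hH [x xb]; split=> [n|]; first by rewrite /step; case: ifP.
by exists x; apply: (adapted1 (fun t : bool => if t then h else 1)).
Qed.

Lemma tower_power_fiber f h : tower_power f -> tower_set (fun x => f x == h).
Proof. by move=> [_ [x xf]]; exists x; apply: (adapted1 (fun a => a == h)). Qed.

(** Countably many elements are all adapted to one stage, which misses its diagonal set; the
    corresponding step function is not among them. *)
Lemma tower_power_uncountable : H != 1%G -> ~ countableT {f | tower_power f}.
Proof.
move=> /trivgPn[h hH h1] [c c_inj].
have ex (n : nat) : exists x, forall f : {f | tower_power f}, c f = n -> adapted (E x) (sval f).
  case: (pselect (exists f, c f = n)) => [[f cf]|nf].
    have [x xf] := (svalP f).2; exists x => g; rewrite -cf => /c_inj -> //.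
  by exists x0 => f cf; case: nf; exists f.
have [x xP] := choice ex; have [z zP] := ubound x.
have [b [bB nb]] := tower_diagonal z; apply: nb.
pose f : {f | tower_power f} := exist _ _ (step_tower_power hH bB).
have : adapted (E z) (fun n => sval f n != 1).
  by apply: (adapted1 (fun a => a != 1)); apply: adapted_le (zP (c f)) (xP _ _ erefl).
congr (adapted _ _); apply/funext => n; rewrite /= /step.
by case: (b n); rewrite ?h1 ?eqxx.
Qed.

(** An element is determined by a stage and a finite table over that stage. *)
Lemma tower_power_index :
  exists g : {f | tower_power f} -> I * nat, injective g.
Proof.
pose U := {n : nat & {ffun n.-tuple bool -> gT}}.
have ex (f : {f | tower_power f}) : exists p : I * U, forall n,
    sval f n = projT2 p.2 (code (E p.1) (projT1 p.2) n).
  have [x [n [C fC]]] := (svalP f).2.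
  exists (x, existT (fun n => {ffun n.-tuple bool -> gT}) n [ffun t => C (tval t)]) => k.
  by rewrite fC /= ffunE.
have [g gP] := choice ex.
exists (fun f => ((g f).1, pickle (g f).2)) => f f' [E1 E2].
have {}E2 := pcan_inj pickleK E2.
have : sval f = sval f' by apply/funext => n; rewrite !gP E1 E2.
by case: f f' {E1 E2} => [f Sf] [f' Sf'] /= E12; apply: eq_exist.
Qed.

End Power.
End Tower.

(** * Length functions *)

Section Length.
Variables (gT : finGroupType) (H : {group gT}).
Variables (S : (nat -> gT) -> Prop) (B : (nat -> bool) -> Prop).
Hypothesis perfectH : [~: H, H]%g = H.
Hypothesis subS : subgroup_of_power H S.
Hypothesis algB : set_algebra B.
Hypothesis stepS : forall h b, h \in H -> B b -> S (step h b).
Hypothesis fiberS : forall f h, S f -> B (fun x => f x == h).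
Hypothesis rankB : forall r, quasirank B r -> exists K, forall b, B b -> r b <= K.
Local Open Scope ring_scope.

Variables (R : archiRealFieldType) (L : (nat -> gT) -> R).
Hypothesis L_ge0 : forall f, S f -> 0 <= L f.
Hypothesis L_mul : forall f g, S f -> S g -> L (pmul f g) <= L f + L g.
Hypothesis L_inv : forall f, S f -> L (pinv f) = L f.

Let ell (b : nat -> bool) : R := \sum_(h in H) L (step h b).

Let ell_ge0 b : B b -> 0 <= ell b.
Proof. by move=> bB; apply: sumr_ge0 => h hH; apply/L_ge0/stepS. Qed.

Let L_step h b : h \in H -> B b -> L (step h b) <= ell b.
Proof.
move=> hH bB; rewrite /ell (bigD1 h) //= lerDl; apply: sumr_ge0 => k /andP[kH _].
exact/L_ge0/stepS.
Qed.

Let Sone : S (pone gT). Proof. by case: subS => _ []. Qed.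
Let Smul f g : S f -> S g -> S (pmul f g). Proof. by case: subS => _ [_ []] + _; apply. Qed.
Let Sinv f : S f -> S (pinv f). Proof. by case: subS => _ [_ []] _; apply. Qed.

(* A commutator [[step x a, step y b]] is supported on the intersection of [a]
   and [b]; perfectness makes every [step h (band a b)] a product of those. *)
Let L_step_and h : h \in H -> exists2 C, 0 <= C & forall a b, B a -> B b ->
  L (step h (band a b)) <= C * (1 + ell a + ell b).
Proof.
rewrite -{1}perfectH => /gen_prodgP[n [c cH ->]].
have cc i : exists x y, [/\ x \in H, y \in H & c i = [~ x, y]%g].
  by have /imset2P[x y xH yH ->] := cH i; exists x, y.
(* Each of the [n] commutators costs [2 * (ell a + ell b)], and the empty product costs
   [L (pone gT)]. *)
exists (L (pone gT) + (2 * n)%:R); first by rewrite addr_ge0 ?L_ge0.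
move=> a b aB bB.
have [_ _ Band _] := algB.
have abB := Band _ _ aB bB.
have pos : 0 <= ell a + ell b by rewrite addr_ge0 ?ell_ge0.
have comm i : L (step (c i) (band a b)) <= 2 * (ell a + ell b) /\ S (step (c i) (band a b)).
  have [x [y [xH yH ->]]] := cc i.
  have -> : step [~ x, y]%g (band a b) =
      pmul (pmul (pinv (step x a)) (pinv (step y b))) (pmul (step x a) (step y b)).
    apply/funext => k; rewrite /step /pmul /pinv /band commgEl conjgE.
    by case: (a k); case: (b k); rewrite /= ?invg1 ?mulg1 ?mul1g ?mulVg ?mulgA.
  have Sx := stepS xH aB; have Sy := stepS yH bB.
  have Sx' := Sinv Sx; have Sy' := Sinv Sy.
  split; last by apply: Smul; apply: Smul.
  have := L_mul (Smul Sx' Sy') (Smul Sx Sy).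
  have := L_mul Sx' Sy'; have := L_mul Sx Sy; rewrite !L_inv //.
  have := L_step xH aB; have := L_step yH bB; lra.
have main (s : seq 'I_n) : S (step (\prod_(i <- s) c i)%g (band a b)) /\
    L (step (\prod_(i <- s) c i)%g (band a b)) <=
    L (pone gT) + (2 * size s)%:R * (ell a + ell b).
  elim: s => [|i s [IS IL]].
    rewrite big_nil mul0r addr0.
    have -> // : step 1 (band a b) = pone gT by apply/funext => k; rewrite /step; case: ifP.
  have [Lc Sc] := comm i.
  have -> : step (\prod_(i <- i :: s) c i)%g (band a b) =
     pmul (step (c i) (band a b)) (step (\prod_(i <- s) c i)%g (band a b)).
    by apply/funext => k; rewrite /step /pmul big_cons; case: ifP; rewrite ?mulg1.
  split; first exact: Smul.
  apply: le_trans (L_mul Sc IS) _.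
  rewrite /= mulnS natrD mulrDl; lra.
have [_] := main (index_enum 'I_n); move/le_trans; apply.
rewrite -[size _]/(size (index_enum _)) /index_enum -enumT size_enum_ord.
have := L_ge0 Sone; have : 0 <= (2 * n)%:R :> R by [].
nra.
Qed.

(** The logarithm of [1 + ell] is a quasirank, so step functions have bounded length; every element
    is a product of at most [#|H|] of them, one for each value. *)
Theorem length_bounded : exists K, forall f, S f -> L f <= K.
Proof.
have [C1 [C1_ge0 C1P]] : exists C, 0 <= C /\ forall a b, B a -> B b ->
    ell (band a b) <= C * (1 + ell a + ell b).
  have ex h : exists C, 0 <= C /\ (h \in H -> forall a b, B a -> B b ->
      L (step h (band a b)) <= C * (1 + ell a + ell b)).
    case: (boolP (h \in H)) => [/L_step_and[C C0 CP]|_]; last by exists 0.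
    by exists C.
  have [C CP] := choice ex; exists (\sum_(h in H) C h).
  split=> [|a b aB bB]; first by apply: sumr_ge0 => h _; case: (CP h).
  rewrite mulr_suml; apply: ler_sum => h hH; have [_] := CP h; exact.
have [BT Bneg Band Bxor] := algB.
pose e1 := ell xpredT.
have e1_ge0 : 0 <= e1 := ell_ge0 BT.
(* The shift by [1] absorbs additive constants into factors. *)
pose m a := 1 + ell a.
have m1 a : B a -> 1 <= m a by move=> aB; rewrite lerDl ell_ge0.
have m_neg a : B a -> m (bneg a) <= (1 + e1) * m a.
  move=> aB; have : ell (bneg a) <= e1 + ell a.
    rewrite /e1 /ell -big_split /=; apply: ler_sum => h hH.
    have -> : step h (bneg a) = pmul (step h xpredT) (pinv (step h a)).
      apply/funext => k; rewrite /step /pmul /pinv /bneg.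
      by case: (a k); rewrite /= ?mulgV ?invg1 ?mulg1.
    rewrite -(L_inv (stepS hH aB)); apply: L_mul; first exact: stepS.
    exact/Sinv/stepS.
  have := ell_ge0 aB; rewrite /m; nra.
have m_and a b : B a -> B b -> m (band a b) <= (1 + C1) * (m a + m b).
  move=> aB bB; have := C1P _ _ aB bB; have := ell_ge0 aB; have := ell_ge0 bB.
  rewrite /m; nra.
have m_xor a b : B a -> B b -> m (bxor a b) <= 2 * (1 + C1) * (1 + e1) * (m a + m b).
  move=> aB bB; have naB := Bneg _ aB; have nbB := Bneg _ bB.
  have : ell (bxor a b) <= ell (band a (bneg b)) + ell (band b (bneg a)).
    rewrite /ell -big_split /=; apply: ler_sum => h hH.
    have -> : step h (bxor a b) = pmul (step h (band a (bneg b))) (step h (band b (bneg a))).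
      apply/funext => k; rewrite /step /pmul /bneg /band /bxor.
      by case: (a k); case: (b k); rewrite /= ?mulg1 ?mul1g.
    by apply: L_mul; apply: stepS => //; apply: Band.
  have := m_and _ _ aB nbB; have := m_and _ _ bB naB.
  have := m_neg _ aB; have := m_neg _ bB; have := m1 _ aB; have := m1 _ bB.
  move=> ma mb na nb h1 h2 h3.
  have h4 : m (bxor a b) <= (1 + C1) * (m a + m b + m (bneg a) + m (bneg b)).
    by move: h1 h2 h3; rewrite /m; nra.
  apply: le_trans h4 _; rewrite -!mulrA [leRHS]mulrCA ler_wpM2l ?addr_ge0 //.
  have : e1 * 1 <= e1 * m a by rewrite ler_wpM2l.
  have : e1 * 1 <= e1 * m b by rewrite ler_wpM2l.
  nra.
(* The worst constant of an operation is doubled, as a sum is at most twice a maximum; adding two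
   keeps the base above [1]. *)
pose D := (Num.bound (4 * (1 + C1) * (1 + e1))).+2.
have DP : 4 * (1 + C1) * (1 + e1) <= D%:R.
  apply: ltW; apply: lt_le_trans (archi_boundP _) _; last by rewrite ler_nat; exact: leqW (leqnSn _).
  by rewrite !mulr_ge0 ?addr_ge0.
have m_op a b c : B a -> B b -> m c <= 2 * (1 + C1) * (1 + e1) * (m a + m b) ->
    m c <= D%:R * Num.max (m a) (m b).
  move=> aB bB h; apply: le_trans h _.
  apply: (@le_trans _ _ (2 * (1 + C1) * (1 + e1) * (2 * Num.max (m a) (m b)))).
    rewrite ler_wpM2l ?mulr_ge0 ?addr_ge0 // [2 * _]mulr_natl mulr2n.
    by rewrite lerD // le_max lexx ?orbT.
  rewrite mulrA ler_wpM2r //; first by rewrite le_max (le_trans ler01) ?m1.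
  by apply: le_trans DP; rewrite le_eqVlt; apply/orP; left; apply/eqP; ring.
have ex a : exists n, m a <= (D ^ n)%:R.
  (* The rank is defined on all sets, and outside [B] the value [m a] may be negative. *)
  exists (Num.bound (m a)); case: (pselect (0 <= m a)) => [h|/negP h].
    apply: ltW; apply: lt_le_trans (archi_boundP h) _; rewrite ler_nat.
    exact: ltnW (ltn_expl _ _).
  by rewrite ltW // (lt_le_trans _ (ler0n _ _)) // ltNge.
pose r a := ex_minn (ex a).
have rm a : m a <= (D ^ r a)%:R by rewrite /r; case: ex_minnP.
have r_le a n : m a <= (D ^ n)%:R -> (r a <= n)%N.
  by rewrite /r; case: ex_minnP => k _; apply.
have m_max a b : Num.max (m a) (m b) <= (D ^ maxn (r a) (r b))%:R.
  rewrite ge_max; apply/andP; split.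
    by apply: le_trans (rm a) _; rewrite ler_nat leq_pexp2l // leq_maxl.
  by apply: le_trans (rm b) _; rewrite ler_nat leq_pexp2l // leq_maxr.
have r_op a b c : B a -> B b -> m c <= 2 * (1 + C1) * (1 + e1) * (m a + m b) ->
    (r c <= (maxn (r a) (r b)).+1)%N.
  move=> aB bB /(m_op _ _ _ aB bB) h; apply: r_le; apply: le_trans h _.
  by rewrite expnS natrM ler_wpM2l.
have [|K KP] := rankB (r := r).
  split=> [a aB|a b aB bB|a b aB bB].
  - rewrite -{1}(maxnn (r a)); apply: r_op => //; apply: le_trans (m_neg _ aB) _.
    have t0 : 0 <= (1 + e1) * m a.
      by apply: mulr_ge0; [apply: addr_ge0 | apply: le_trans ler01 (m1 _ aB)].
    have := mulr_ge0 C1_ge0 t0; lra.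
  - apply: r_op => //; apply: le_trans (m_and _ _ aB bB) _.
    rewrite -!mulrA [leRHS]mulrCA ler_wpM2l ?addr_ge0 //.
    have t0 : 0 <= m a + m b by have := m1 _ aB; have := m1 _ bB; lra.
    have := mulr_ge0 e1_ge0 t0; lra.
  - by apply: r_op => //; apply: m_xor.
pose M : R := (D ^ K)%:R.
have LM h b : h \in H -> B b -> L (step h b) <= M.
  move=> hH bB; apply: le_trans (L_step hH bB) _.
  apply: (@le_trans _ _ (m b)); first by rewrite lerDr.
  apply: le_trans (rm b) _; rewrite ler_nat leq_pexp2l //; exact: KP.
exists (L (pone gT) + #|H|%:R * M) => f Sf.
(* The values of [f] are peeled off one by one, each through the step function on its fiber. *)
have main (s : seq gT) : uniq s -> {subset s <= H} ->
    S (fun x => if f x \in s then f x else 1%g) /\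
    L (fun x => if f x \in s then f x else 1%g) <= L (pone gT) + (size s)%:R * M.
  elim: s => [|h s IHs] /=; first by rewrite mul0r addr0.
  move=> /andP[hs us] sH; have [|Ss Ls] := IHs us.
    by move=> k ks; apply: sH; rewrite inE ks orbT.
  have hH : h \in H by apply: sH; rewrite inE eqxx.
  have hB := fiberS h Sf; have Sh := stepS hH hB.
  have -> : (fun x => if f x \in h :: s then f x else 1%g) =
     pmul (step h (fun x => f x == h)) (fun x => if f x \in s then f x else 1%g).
    apply/funext => x; rewrite /pmul /step inE.
    by case: eqP => [->|_] /=; rewrite ?mul1g // (negbTE hs) mulg1.
  split; first exact: Smul.
  apply: le_trans (L_mul Sh Ss) _; have := LM _ _ hH hB.
  rewrite -addn1 natrD mulrDl mul1r; lra.
have [|_] := main (enum H) (enum_uniq _); first by move=> k; rewrite mem_enum.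
have -> : (fun x => if f x \in enum H then f x else 1%g) = f.
  apply/funext => x; rewrite mem_enum ifT //; case: subS => SH _; exact: SH.
by rewrite -cardE.
Qed.

End Length.

(** * Isometric actions and the final assembly *)

Lemma strongly_bounded_length (gT : finGroupType) (H : {group gT})
    (S : (nat -> gT) -> Prop) : subgroup_of_power H S ->
  (forall L : (nat -> gT) -> RR, (forall f, S f -> 0 <= L f)%R ->
    (forall f g, S f -> S g -> L (pmul f g) <= L f + L g)%R ->
    (forall f, S f -> L (pinv f) = L f) ->
    exists K, forall f, S f -> (L f <= K)%R) ->
  strongly_bounded S.
Proof.
move=> [_ [S1 [SM SV]]] bL X d [d0 [_ [dC dT]]] act act1 actM actI x.
have actV f : S f -> act f (act (pinv f) x) = x.
  move=> Sf; rewrite -actM //; last exact: SV.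
  rewrite (_ : pmul f (pinv f) = pone gT) ?act1 //.
  by apply/funext => n; rewrite /pmul /pinv mulgV.
(* The displacement of the base point is a length function. *)
have [|||K KP] := bL (fun f => d x (act f x)).
- by [].
- move=> f g Sf Sg; rewrite actM //; apply: le_trans (dT _ (act f x) _) _.
  by rewrite actI.
- by move=> f Sf; rewrite -(actI f) // actV // dC.
exists (K + K)%R => f g Sf Sg; apply: le_trans (dT _ x _) _.
by rewrite lerD // ?[d _ x]dC; exact: KP.
Qed.

(** Each null set of a cofinal family contributes countably many slaloms, hence the index [I * nat];
    every [g] is captured through a null set containing [coded_null g]. *)
Lemma slaloms_aleph1 : cof_LM_eq_aleph1 -> exists (I : Type) (T : I * nat -> nat -> seq nat),
  [/\ card_aleph1 I, forall a n, size (T a n) <= 2 ^ n.+1 * 2 ^ n.+1 &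
    forall g : nat -> nat, exists a, forall n, g n \in T a n].
Proof.
move=> [[I [F [I1 [Fnull Fcof]]]] _].
have [S SP] := choice (fun i => negligible_slaloms (Fnull i)).
exists I, (fun a => S a.1 a.2); split=> // [a n|g]; first by case: (SP a.1).
have [i gi] := Fcof _ (coded_null_negligible RR g).
by have [_ /(_ g gi)[k gk]] := SP i; exists (i, k).
Qed.

Theorem theoremB :
  cof_LM_eq_aleph1 ->
  forall (gT : finGroupType) (H : {group gT}),
    H != 1%G -> [~: H, H]%g = H ->
    exists S : (nat -> gT) -> Prop,
      subgroup_of_power H S /\ strongly_bounded S /\ card_aleph1 {f : nat -> gT | S f}.
Proof.
move=> /slaloms_aleph1[I [T [[ncI [lt [irr [tr [tot [wf seg]]]]]] szT capT]]] gT H nH pH.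
pose w n := 2 ^ n.+1 * 2 ^ n.+1.
have ub := sequence_bounded tot seg ncI.
have [x0 _] : exists x0 : I, True.
  by apply: contrapT => nI; apply: ncI; exists (fun=> 0) => x; case: nI; exists x.
have [E EP] := tower_exists wf seg (tower_op w T) xpred0.
exists (tower_power E H).
have sub := tower_power_subgroup EP ub x0 H.
have alB := tower_algebra EP ub x0.
split=> //; split.
  apply: (strongly_bounded_length sub) => L L0 LM LV.
  apply: (length_bounded pH sub alB) L0 LM LV.
  - exact: step_tower_power.
  - exact: tower_power_fiber.
  - move=> r; apply: (quasirank_bounded alB szT capT); exact: tower_rich EP ub.
have [g g_inj] := tower_power_index E H.
exact: (card_aleph1_inj irr tr tot wf seg g_inj (tower_power_uncountable EP ub x0 nH)).
Qed.
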